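(* Let $\mathbb{D}_Q\subset\mathbb{M}^d$ be a nc operator ball and let $\mathcal{A}$ be either $A(\mathbb{D}_Q)$ or $H^\infty(\mathbb{D}_Q)$. There exists a continuous surjection $\pi:\operatorname{Rep}^{cc}(\mathcal{A})\to\overline{\mathbb{D}_Q}$ determined by $\pi(\Phi)=\Phi(Z)=(\Phi(Z_1),\dots,\Phi(Z_d))$. If $\mathcal{A}=A(\mathbb{D}_Q)$ then $\pi$ is a homeomorphism. If $\mathcal{A}=H^\infty(\mathbb{D}_Q)$ then the restriction of $\pi$ to the bounded-pointwise continuous representations in $\pi^{-1}(\mathbb{D}_Q)$ is a homeomorphism onto $\mathbb{D}_Q$.
   Context: $M_n^d$ is the set of $d$-tuples of complex $n\times n$ matrices ($M_n=M_n^1$); $\mathbb{M}^d=\sqcup_{n\ge1}M_n^d$; for $\Omega\subseteq\mathbb{M}^d$, $\Omega(n)=\Omega\cap M_n^d$. A nc function $f:\Omega\to\mathbb{M}^1$ on a set $\Omega$ closed under direct sums is a graded map ($X\in\Omega(n)\Rightarrow f(X)\in M_n$) with $f(X\oplus Y)=f(X)\oplus f(Y)$ and $f(S^{-1}XS)=S^{-1}f(X)S$ whenever $S\in GL_n$ and $X,S^{-1}XS\in\Omega(n)$. NC operator ball: given Hilbert spaces $\mathcal{R},\mathcal{S}$ and linearly independent $Q_1,\dots,Q_d\in\mathcal{L}(\mathcal{R},\mathcal{S})$, put $Q(X)=\sum_jQ_j\otimes X_j$ for $X\in\mathbb{M}^d$ and $\mathbb{D}_Q=\{X\in\mathbb{M}^d:\|Q(X)\|<1\}$;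 $\overline{\mathbb{D}_Q}=\{X:\|Q(X)\|\le1\}$ is its level-wise closure. $H^\infty(\mathbb{D}_Q)$ is the algebra of bounded nc functions $\mathbb{D}_Q\to\mathbb{M}^1$ with norm $\|f\|=\sup_{X\in\mathbb{D}_Q}\|f(X)\|$ and matrix norms $\|[f_{jk}]\|=\sup_{X\in\mathbb{D}_Q}\|[f_{jk}(X)]\|$; $A(\mathbb{D}_Q)$ is the norm closure of the free nc polynomials. $Z_1,\dots,Z_d$ are the coordinate functions. The bounded-pointwise topology on $H^\infty(\mathbb{D}_Q)$ is the weakest topology in which a bounded net $F^{(\kappa)}$ converges to $F$ if and only if $F^{(\kappa)}(X)\to F(X)$ in norm for every $X\in\mathbb{D}_Q$. $\operatorname{Rep}^{cc}(\mathcal{A})=\sqcup_{n\ge1}\operatorname{Rep}_n^{cc}(\mathcal{A})$, where $\operatorname{Rep}_n^{cc}(\mathcal{A})$ is the space of completely contractive unital representations (homomorphisms) $\mathcal{A}\to M_n$, with the topology of pointwise convergence on $\mathcal{A}$. Continuity and homeomorphism are understood level by level: $\pi$ maps $\operatorname{Rep}_n^{cc}(\mathcal{A})$ to $\overline{\mathbb{D}_Q(n)}$.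
   Formalization: The bounded-pointwise topology is taken as the finest, not the weakest, topology in which bounded nets converge iff they converge pointwise; in the literally weakest one no unital representation of H^∞ is continuous, so the last claim would fail. *)

(* Defs.v *)
From HB Require Import structures.
From mathcomp Require Import all_boot all_order all_algebra.
From mathcomp Require Import all_classical all_reals all_analysis.
From mathcomp Require Import ring.
From mathcomp.real_closed Require Export complex.

Set Implicit Arguments.
Unset Strict Implicit.
Unset Printing Implicit Defensive.

Import Order.TTheory GRing.Theory Num.Theory numFieldNormedType.Exports.

Local Open Scope classical_set_scope.
Local Open Scope ring_scope.
Local Open Scope complex_scope.

(* The norm topology of the complex numbers, otherwise available only on the
   regular module R[i]^o. *)
HB.instance Definition _ (R : realType) :=
  PseudoPointedMetric.copy R[i] R[i]^o.
HB.instance Definition _ (R : realType) := NormedModule.copy R[i] R[i]^o.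

(* A complete normed space whose norm comes from an inner product (linear in
   the first variable). *)
Definition hilbert (R : realType) (H : completeNormedModType R[i]) : Prop :=
  exists dot : {dot H for Num.conj}, forall x : H, dot x x = `|x| ^+ 2.

Definition lin_indep (R : realType) (H K : lmodType R[i]) (d : nat)
    (Q : 'I_d -> {linear H -> K}) : Prop :=
  forall a : 'I_d -> R[i],
    (forall x : H, \sum_j a j *: Q j x = 0) -> forall j, a j = 0.

Section OperatorNorm.
Context {R : realType}.
Local Notation C := R[i].

(* Norm of the Hilbert sum V^n, which is V (x) C^n when V is a Hilbert space.
   Norms over C are C-valued, hence Re. *)
Definition l2norm (V : normedModType C) (n : nat) (v : 'I_n -> V) : R :=
  Num.sqrt (\sum_i (complex.Re `|v i|) ^+ 2).

Definition opnorm (V W : normedModType C) (n m : nat)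
    (T : ('I_n -> V) -> 'I_m -> W) : \bar R :=
  ereal_sup [set (l2norm (T v))%:E | v in [set v | l2norm v <= 1]].

Definition mxapp (m n : nat) (A : 'M[C]_(m, n)) (v : 'I_n -> C) : 'I_m -> C :=
  fun i => \sum_k A i k * v k.

Definition mxnorm (m n : nat) (A : 'M[C]_(m, n)) : \bar R := opnorm (mxapp A).

Arguments mxnorm {m n} A%_R.

Lemma opnorm_leP (V W : normedModType C) n m (T : ('I_n -> V) -> 'I_m -> W)
    (M : \bar R) :
  (opnorm T <= M)%E <->
  (forall v, l2norm v <= 1 -> ((l2norm (T v))%:E <= M)%E).
Proof.
split=> [TM v v1|TM].
  by apply: le_trans TM; apply: ereal_sup_ubound; exists v.
by apply: ge_ereal_sup => _ [v v1 <-]; exact: TM.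
Qed.

Lemma l2norm_ge0 (V : normedModType C) n (v : 'I_n -> V) : 0 <= l2norm v.
Proof. exact: sqrtr_ge0. Qed.

Lemma Re_norm_ge0 (V : normedModType C) (x : V) : 0 <= complex.Re `|x|.
Proof. by have := normr_ge0 x; rewrite lecE => /andP[_ h]; exact: h. Qed.

Lemma Re_norm (V : normedModType C) (x : V) : (complex.Re `|x|)%:C = `|x|.
Proof. exact/RRe_real/ger0_real. Qed.

Lemma Re_normD (V : normedModType C) (x y : V) :
  complex.Re `|x + y| <= complex.Re `|x| + complex.Re `|y|.
Proof.
by have := ler_normD x y; rewrite lecE !raddfD => /andP[_ h]; exact: h.
Qed.

Lemma Re_normZ (V : normedModType C) (a : C) (x : V) :
  complex.Re `|a *: x| = complex.Re `|a| * complex.Re `|x|.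
Proof.
rewrite normrZ -{1}(Re_norm x) -[`|a| in LHS](@Re_norm C a).
by rewrite -rmorphM.
Qed.

Lemma l2norm_sqr (V : normedModType C) n (v : 'I_n -> V) :
  l2norm v ^+ 2 = \sum_i (complex.Re `|v i|) ^+ 2.
Proof. by rewrite sqr_sqrtr// sumr_ge0// => i _; exact: sqr_ge0. Qed.

Lemma l2normZ (V : normedModType C) n (a : C) (v : 'I_n -> V) :
  l2norm (fun i => a *: v i) = complex.Re `|a| * l2norm v.
Proof.
apply/eqP; rewrite -(@eqrXn2 _ 2) ?mulr_ge0 ?l2norm_ge0 ?(@Re_norm_ge0 C)//.
rewrite exprMn !l2norm_sqr mulr_sumr; apply/eqP/eq_bigr => i _.
by rewrite Re_normZ exprMn.
Qed.

Lemma l2norm0 (V : normedModType C) n : l2norm (fun _ : 'I_n => 0 : V) = 0.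
Proof.
by rewrite /l2norm big1 ?sqrtr0// => i _; rewrite normr0 expr0n.
Qed.

(* A crude form of the triangle inequality, enough to see that boundedness is
   stable under sums. *)
Lemma l2normD2 (V : normedModType C) n (v w : 'I_n -> V) :
  l2norm (fun i => v i + w i) <= 2 * (l2norm v + l2norm w).
Proof.
rewrite -(@ler_pXn2r _ 2) ?nnegrE ?mulr_ge0 ?addr_ge0 ?l2norm_ge0//.
have sqD (a b c : R) : 0 <= a -> a <= b + c -> a ^+ 2 <= 2 * (b ^+ 2 + c ^+ 2).
  move=> a0 abc; rewrite -subr_ge0.
  have -> : 2 * (b ^+ 2 + c ^+ 2) - a ^+ 2 =
    (b - c) ^+ 2 + (b + c - a) ^+ 2 + 2 * (a * (b + c - a)) by ring.
  by rewrite !addr_ge0 ?sqr_ge0// !mulr_ge0// subr_ge0.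
have h : l2norm (fun i => v i + w i) ^+ 2 <= 2 * (l2norm v ^+ 2 + l2norm w ^+ 2).
  rewrite !l2norm_sqr -big_split mulr_sumr; apply: ler_sum => i _ /=.
  exact: sqD (Re_norm_ge0 _) (Re_normD _ _).
have sqD2 (b c : R) : 0 <= b -> 0 <= c ->
  2 * (b ^+ 2 + c ^+ 2) <= (2 * (b + c)) ^+ 2.
  move=> b0 c0; rewrite -subr_ge0.
  have -> : (2 * (b + c)) ^+ 2 - 2 * (b ^+ 2 + c ^+ 2) =
    2 * (b ^+ 2 + c ^+ 2) + 8 * (b * c) by ring.
  by rewrite !(addr_ge0, mulr_ge0, sqr_ge0).
exact: le_trans h (sqD2 _ _ (l2norm_ge0 v) (l2norm_ge0 w)).
Qed.

Lemma mxappD m n (A B : 'M[C]_(m, n)) v :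
  mxapp (A + B) v = fun i => mxapp A v i + mxapp B v i.
Proof.
by apply/funext => i; rewrite /mxapp -big_split; apply: eq_bigr => k _;
  rewrite mxE mulrDl.
Qed.

Lemma mxappZ m n (a : C) (A : 'M[C]_(m, n)) v :
  mxapp (a *: A) v = fun i => a *: mxapp A v i.
Proof.
apply/funext => i; rewrite /mxapp scaler_sumr; apply: eq_bigr => k _.
by rewrite mxE -mulrA.
Qed.

Lemma mxappM m n p (A : 'M[C]_(m, n)) (B : 'M[C]_(n, p)) v :
  mxapp (A *m B) v = mxapp A (mxapp B v).
Proof.
apply/funext => i; rewrite /mxapp.
under [RHS]eq_bigr do rewrite mulr_sumr.
rewrite exchange_big; apply: eq_bigr => k _.
by rewrite mxE mulr_suml; apply: eq_bigr => j _; rewrite mulrA.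
Qed.

Lemma mxapp1 n v : mxapp (1%:M : 'M[C]_n) v = v.
Proof.
apply/funext => i; rewrite /mxapp (bigD1 i)//= big1 => [|k ki].
  by rewrite mxE eqxx mul1r addr0.
by rewrite mxE eq_sym (negbTE ki) mul0r.
Qed.

Lemma mxapp_scale m n (A : 'M[C]_(m, n)) (a : C) v :
  mxapp A (fun k => a *: v k) = fun i => a *: mxapp A v i.
Proof.
apply/funext => i; rewrite /mxapp scaler_sumr; apply: eq_bigr => k _.
exact: mulrCA.
Qed.

Lemma mxnorm_ge0 m n (A : 'M[C]_(m, n)) : (0 <= mxnorm A)%E.
Proof.
apply: ereal_sup_ubound; exists (fun=> 0); first by rewrite /= l2norm0.
congr (_%:E); rewrite -[RHS](l2norm0 C m); congr l2norm.
by apply/funext => i; rewrite /mxapp big1// => k _; rewrite mulr0.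
Qed.

Lemma l2norm_eq0 (V : normedModType C) n (v : 'I_n -> V) :
  l2norm v = 0 -> v = fun=> 0.
Proof.
move=> v0; apply/funext => i.
have : \sum_i (complex.Re `|v i|) ^+ 2 = 0 by rewrite -l2norm_sqr v0 expr0n.
move/psumr_eq0P => /(_ (fun i _ => sqr_ge0 _)) /(_ i isT)/eqP.
by rewrite sqrf_eq0 => /eqP vi0; apply/normr0_eq0; rewrite -Re_norm vi0.
Qed.

Lemma mxnorm_leP m n (A : 'M[C]_(m, n)) (M : R) :
  (mxnorm A <= M%:E)%E <->
  0 <= M /\ forall v, l2norm (mxapp A v) <= M * l2norm v.
Proof.
split=> [AM|[M0 AM]]; last first.
  apply/opnorm_leP => v v1; rewrite lee_fin (le_trans (AM v))//.
  by rewrite -[leRHS]mulr1 ler_wpM2l.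
have M0 : 0 <= M by have := le_trans (mxnorm_ge0 A) AM; rewrite lee_fin.
split=> // v.
have [v0|v0] := eqVneq (l2norm v) 0.
  have -> : mxapp A v = fun=> 0.
    apply/funext => i; rewrite /mxapp big1// => k _.
    by rewrite (l2norm_eq0 v0) mulr0.
  by rewrite l2norm0 v0 mulr0.
have vp : 0 < l2norm v by rewrite lt_neqAle eq_sym v0 l2norm_ge0.
have ReV : complex.Re `|((l2norm v)^-1)%:C| = (l2norm v)^-1.
  by rewrite ger0_norm// lecR invr_ge0 ltW.
move/opnorm_leP : AM => /(_ (fun k => ((l2norm v)^-1)%:C *: v k)).
rewrite mxapp_scale !l2normZ ReV mulVf// lexx lee_fin => /(_ isT).
by rewrite ler_pdivrMl// mulrC.
Qed.

Lemma mxnormD2 m n (A B : 'M[C]_(m, n)) (a b : R) :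
  (mxnorm A <= a%:E -> mxnorm B <= b%:E ->
   mxnorm (A + B) <= (2 * (a + b))%:E)%E.
Proof.
move=> /mxnorm_leP[a0 Aa] /mxnorm_leP[b0 Bb]; apply/mxnorm_leP; split.
  by rewrite mulr_ge0 ?addr_ge0.
move=> v; rewrite mxappD (le_trans (l2normD2 _ _))// -mulrA ler_pM2l//.
by rewrite mulrDl lerD.
Qed.

Lemma mxnormZ_le m n (c : C) (A : 'M[C]_(m, n)) (a : R) :
  (mxnorm A <= a%:E -> mxnorm (c *: A) <= (complex.Re `|c| * a)%:E)%E.
Proof.
move=> /mxnorm_leP[a0 Aa]; have c0 := @Re_norm_ge0 C c.
apply/mxnorm_leP; split; first by rewrite mulr_ge0.
by move=> v; rewrite mxappZ l2normZ -mulrA ler_wpM2l.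
Qed.

Lemma mxnormM_le m n p (A : 'M[C]_(m, n)) (B : 'M[C]_(n, p)) (a b : R) :
  (mxnorm A <= a%:E -> mxnorm B <= b%:E ->
   mxnorm (A *m B) <= (a * b)%:E)%E.
Proof.
move=> /mxnorm_leP[a0 Aa] /mxnorm_leP[b0 Bb]; apply/mxnorm_leP; split.
  by rewrite mulr_ge0.
by move=> v; rewrite mxappM (le_trans (Aa _))// -mulrA ler_wpM2l.
Qed.

Lemma mxnorm1_le n : (mxnorm (1%:M : 'M[C]_n) <= 1%:E)%E.
Proof. by apply/mxnorm_leP; split => // v; rewrite mxapp1 mul1r. Qed.

End OperatorNorm.
Arguments mxnorm {R m n} A%_R.

Notation mxtuple R d n := {ptws 'I_d -> 'M[R[i]]_n}.

Section OperatorBall.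
Context {R : realType} {H K : completeNormedModType R[i]} {d : nat}.
Variable Q : 'I_d -> {linear H -> K}.
Local Notation C := R[i].

(* Q(X) = \sum_j Q_j (x) X_j, acting on H^n = H (x) C^n *)
Definition ncop (n : nat) (X : mxtuple R d n) (v : 'I_n -> H) : 'I_n -> K :=
  fun i => \sum_j \sum_k X j i k *: Q j (v k).

(* The levels of the ball and of its closure; level 0 is excluded. *)
Definition ncball (n : nat) : set (mxtuple R d n) :=
  [set X | (0 < n)%N /\ (opnorm (ncop X) < 1)%E].

Definition cncball (n : nat) : set (mxtuple R d n) :=
  [set X | (0 < n)%N /\ (opnorm (ncop X) <= 1)%E].

Arguments ncball : clear implicits.
Arguments cncball : clear implicits.

(* Graded maps on the ball, with the pointwise algebra structure. *)
Definition gmap : Type := forall n : nat, ncball n -> 'M[C]_n.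

HB.instance Definition _ := gen_eqMixin gmap.
HB.instance Definition _ := gen_choiceMixin gmap.

Lemma gmapP (f g : gmap) : (forall n X, f n X = g n X) -> f = g.
Proof. by move=> fg; apply/functional_extensionality_dep => n; apply/funext. Qed.

Let gadd (f g : gmap) : gmap := fun n X => f n X + g n X.
Let gopp (f : gmap) : gmap := fun n X => - f n X.
Let gzero : gmap := fun n X => 0.
Let gone : gmap := fun n X => 1%:M.
Let gmul (f g : gmap) : gmap := fun n X => f n X *m g n X.
Let gscale (c : C) (f : gmap) : gmap := fun n X => c *: f n X.

Let gaddA : associative gadd.
Proof. by move=> f g h; apply: gmapP => n X; exact: addrA. Qed.
Let gaddC : commutative gadd.
Proof. by move=> f g; apply: gmapP => n X; exact: addrC. Qed.
Let gadd0 : left_id gzero gadd.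
Proof. by move=> f; apply: gmapP => n X; exact: add0r. Qed.
Let gaddN : left_inverse gzero gopp gadd.
Proof. by move=> f; apply: gmapP => n X; exact: addNr. Qed.
HB.instance Definition _ := GRing.isZmodule.Build gmap gaddA gaddC gadd0 gaddN.

Lemma ncball0 : ncball 1%N (fun=> 0).
Proof.
split=> //; apply: le_lt_trans (@lte01 _); apply/opnorm_leP => v _.
suff -> : ncop (fun=> 0 : 'M[C]_1) v = fun=> 0 by rewrite l2norm0.
apply/funext => i; rewrite /ncop big1// => j _; rewrite big1// => k _.
by rewrite mxE scale0r.
Qed.

Let ncball_pt0 : ncball 1%N := SigSub (mem_set ncball0).

Let gmulA : associative gmul.
Proof. by move=> f g h; apply: gmapP => n X; exact: mulmxA. Qed.
Let gmul1l : left_id gone gmul.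
Proof. by move=> f; apply: gmapP => n X; exact: mul1mx. Qed.
Let gmul1r : right_id gone gmul.
Proof. by move=> f; apply: gmapP => n X; exact: mulmx1. Qed.
Let gmulDl : left_distributive gmul +%R.
Proof. by move=> f g h; apply: gmapP => n X; exact: mulmxDl. Qed.
Let gmulDr : right_distributive gmul +%R.
Proof. by move=> f g h; apply: gmapP => n X; exact: mulmxDr. Qed.
Let gone_neq0 : gone != 0.
Proof.
apply/eqP => /(congr1 (fun f : gmap => f 1%N ncball_pt0)).
by move=> /matrixP/(_ 0 0); rewrite !mxE => /eqP; rewrite oner_eq0.
Qed.
HB.instance Definition _ := GRing.Zmodule_isNzRing.Build gmap
  gmulA gmul1l gmul1r gmulDl gmulDr gone_neq0.

Let gscaleA a b f : gscale a (gscale b f) = gscale (a * b) f.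
Proof. by apply: gmapP => n X; exact: scalerA. Qed.
Let gscale1 : left_id 1 gscale.
Proof. by move=> f; apply: gmapP => n X; exact: scale1r. Qed.
Let gscaleDr : right_distributive gscale +%R.
Proof. by move=> a f g; apply: gmapP => n X; exact: scalerDr. Qed.
Let gscaleDl f : {morph gscale^~ f : a b / a + b}.
Proof. by move=> a b; apply: gmapP => n X; exact: scalerDl. Qed.
HB.instance Definition _ := GRing.Zmodule_isLmodule.Build C gmap
  gscaleA gscale1 gscaleDr gscaleDl.

Let gscaleAl (a : C) (f g : gmap) : a *: (f * g) = (a *: f) * g.
Proof. by apply: gmapP => n X; exact: scalemxAl. Qed.
HB.instance Definition _ := GRing.Lmodule_isLalgebra.Build C gmap gscaleAl.
Let gscaleAr (a : C) (f g : gmap) : a *: (f * g) = f * (a *: g).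
Proof. by apply: gmapP => n X; exact: scalemxAr. Qed.
HB.instance Definition _ := GRing.Lalgebra_isAlgebra.Build C gmap gscaleAr.

(* The direct sum (resp. conjugate) is a point Z of the ball with prescribed
   value, so that no membership proof enters the definition. *)
Definition nc_function (f : gmap) : Prop :=
  (forall n m (X : ncball n) (Y : ncball m) (Z : ncball (n + m)),
     (forall j, val Z j = block_mx (val X j) 0 0 (val Y j)) ->
     f (n + m)%N Z = block_mx (f n X) 0 0 (f m Y)) /\
  (forall n (S : 'M[C]_n) (X Y : ncball n), S \in unitmx ->
     (forall j, val Y j = invmx S *m val X j *m S) ->
     f n Y = invmx S *m f n X *m S).

(* The matrix norms || [F_ij] || = sup_X || [F_ij(X)] || *)
Definition gmatnorm (k : nat) (F : 'I_k -> 'I_k -> gmap) : \bar R :=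
  ereal_sup [set r | exists n (X : ncball n),
    r = mxnorm (\mxblock_(i < k, j < k) F i j n X)].

Definition gnorm (f : gmap) : \bar R :=
  ereal_sup [set r | exists n (X : ncball n), r = mxnorm (f n X)].

Arguments gnorm f%_R.

Definition Hinf : {pred gmap} :=
  mem [set f | nc_function f /\ (gnorm f < +oo)%E].

Definition gcoord (j : 'I_d) : gmap := fun n X => val X j.

(* A free nc polynomial, as a list of (coefficient, word). *)
Definition ncpoly : Type := seq (C * seq 'I_d).

Definition ncpoly_map (p : ncpoly) : gmap :=
  \sum_(t <- p) t.1 *: \prod_(j <- t.2) gcoord j.

(* The norm closure of the free polynomials in H^oo. *)
Definition ballA : {pred gmap} :=
  mem [set f | f \in Hinf /\ forall e : R, 0 < e ->
    exists p : ncpoly, (gnorm (f - ncpoly_map p) < e%:E)%E].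

Lemma gnorm_leP (f : gmap) (M : \bar R) :
  (gnorm f <= M)%E <-> (forall n (X : ncball n), mxnorm (f n X) <= M)%E.
Proof.
split=> [fM n X|fM]; last by apply: ge_ereal_sup => _ [n [X ->]]; exact: fM.
by apply: le_trans fM; apply: ereal_sup_ubound; exists n, X.
Qed.

Lemma gnorm_ge0 (f : gmap) : (0 <= gnorm f)%E.
Proof.
apply: le_trans (mxnorm_ge0 (f 1%N ncball_pt0)) _.
by have /gnorm_leP := lexx (gnorm f); exact.
Qed.

Lemma gnorm_fin (f : gmap) : (gnorm f < +oo)%E -> (gnorm f <= (fine (gnorm f))%:E)%E.
Proof. by move=> fb; rewrite fineK// ge0_fin_numE// gnorm_ge0. Qed.

Lemma gnorm_bounded (f : gmap) (M : R) : (gnorm f <= M%:E)%E -> (gnorm f < +oo)%E.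
Proof. by move=> /le_lt_trans; apply; exact: ltry. Qed.

Lemma gnormD2 (f g : gmap) (a b : R) :
  (gnorm f <= a%:E -> gnorm g <= b%:E -> gnorm (f + g) <= (2 * (a + b))%:E)%E.
Proof.
move=> /gnorm_leP fa /gnorm_leP gb; apply/gnorm_leP => n X.
exact: mxnormD2 (fa _ _) (gb _ _).
Qed.

Lemma gnormM_le (f g : gmap) (a b : R) :
  (gnorm f <= a%:E -> gnorm g <= b%:E -> gnorm (f * g) <= (a * b)%:E)%E.
Proof.
move=> /gnorm_leP fa /gnorm_leP gb; apply/gnorm_leP => n X.
exact: mxnormM_le (fa _ _) (gb _ _).
Qed.

Lemma gnormZ_le (c : C) (f : gmap) (a : R) :
  (gnorm f <= a%:E -> gnorm (c *: f) <= (complex.Re `|c| * a)%:E)%E.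
Proof.
by move=> /gnorm_leP fa; apply/gnorm_leP => n X; exact: mxnormZ_le (fa _ _).
Qed.

Lemma gnorm1_le : (gnorm 1 <= 1%:E)%E.
Proof. by apply/gnorm_leP => n X; exact: mxnorm1_le. Qed.

Lemma in_Hinf (f : gmap) :
  (f \in Hinf) <-> nc_function f /\ (gnorm f < +oo)%E.
Proof. by split=> [/set_mem|/mem_set]. Qed.

Lemma Hinf_subalg : GRing.subalg_closed Hinf.
Proof.
split.
- apply/in_Hinf; split; last exact: gnorm_bounded gnorm1_le.
  split=> [n m X Y Z _|n S X Y Su _]; first exact: scalar_mx_block.
  by rewrite [X in _ = _ *m X *m _](_ : _ = 1%:M)// mulmx1 mulVmx.
- move=> a f g /in_Hinf[[fs fc] fb] /in_Hinf[[gs gc] gb]; apply/in_Hinf; split.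
    split=> [n m X Y Z ZE|n S X Y Su YE].
      rewrite [LHS](_ : _ = a *: f _ Z + g _ Z)// (fs _ _ _ _ _ ZE).
      by rewrite (gs _ _ _ _ _ ZE) scale_block_mx add_block_mx !scaler0 !addr0.
    rewrite [LHS](_ : _ = a *: f _ Y + g _ Y)// (fc _ _ _ _ Su YE).
    by rewrite (gc _ _ _ _ Su YE) scalemxAl scalemxAr -mulmxDl -mulmxDr.
  exact: gnorm_bounded (gnormD2 (gnormZ_le a (gnorm_fin fb)) (gnorm_fin gb)).
- move=> f g /in_Hinf[[fs fc] fb] /in_Hinf[[gs gc] gb]; apply/in_Hinf; split.
    split=> [n m X Y Z ZE|n S X Y Su YE].
      rewrite [LHS](_ : _ = f _ Z *m g _ Z)// (fs _ _ _ _ _ ZE).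
      rewrite (gs _ _ _ _ _ ZE) mulmx_block !mulmx0 !mul0mx !addr0 !add0r.
      by [].
    rewrite [LHS](_ : _ = f _ Y *m g _ Y)// (fc _ _ _ _ Su YE).
    by rewrite (gc _ _ _ _ Su YE) !mulmxA mulmxK.
  exact: gnorm_bounded (gnormM_le (gnorm_fin fb) (gnorm_fin gb)).
Qed.

Lemma ncpoly_mapD p q : ncpoly_map (p ++ q) = ncpoly_map p + ncpoly_map q.
Proof. exact: big_cat. Qed.

Lemma ncpoly_mapZ a p :
  ncpoly_map [seq (a * t.1, t.2) | t <- p] = a *: ncpoly_map p.
Proof.
rewrite /ncpoly_map big_map scaler_sumr.
by apply: eq_bigr => t _; rewrite scalerA.
Qed.

Lemma ncpoly_mapM p q :
  ncpoly_map [seq (t.1 * u.1, t.2 ++ u.2) | t <- p, u <- q] =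
  ncpoly_map p * ncpoly_map q.
Proof.
rewrite /ncpoly_map big_allpairs_dep mulr_suml; apply: eq_bigr => t _.
rewrite mulr_sumr; apply: eq_bigr => u _.
by rewrite big_cat -scalerAl -scalerAr scalerA.
Qed.

Lemma in_ballA (f : gmap) : (f \in ballA) <-> f \in Hinf /\
  forall e : R, 0 < e -> exists p, (gnorm (f - ncpoly_map p) <= e%:E)%E.
Proof.
split=> [/set_mem[fH fp]|[fH fp]].
  by split=> // e /fp[p /ltW]; exists p.
apply/mem_set; split=> // e e0; have [|p pe] := fp (e / 2).
  by rewrite divr_gt0.
exists p; apply: le_lt_trans pe _.
by rewrite lte_fin ltr_pdivrMr// ltr_pMr// ltr1n.
Qed.

Lemma ballA_subalg : GRing.subalg_closed ballA.
Proof.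
have [H1 HL HM] := Hinf_subalg; split.
- apply/in_ballA; split=> // e e0; exists [:: (1, [::])].
  rewrite /ncpoly_map big_seq1 big_nil scale1r subrr.
  apply/gnorm_leP => n X; apply/mxnorm_leP; split; first exact: ltW.
  move=> v; rewrite [M in mxapp M](_ : _ = (0 : C) *: (0 : 'M[C]_n)).
    2: by rewrite scaler0.
  rewrite mxappZ l2normZ normr0 mul0r.
  by rewrite mulr_ge0 ?l2norm_ge0// ltW.
- move=> a f g /in_ballA[fH fp] /in_ballA[gH gp]; apply/in_ballA.
  split; first exact: HL.
  move=> e e0; set c := complex.Re `|a|; have c0 : 0 <= c := @Re_norm_ge0 R C a.
  have [|p pe] := fp (e / (4 * (c + 1))).
    by rewrite divr_gt0// mulr_gt0// ltr_wpDl.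
  have [|q qe] := gp (e / 4); first by rewrite divr_gt0.
  exists ([seq (a * t.1, t.2) | t <- p] ++ q).
  rewrite ncpoly_mapD ncpoly_mapZ opprD addrACA -scalerBr.
  apply: le_trans (gnormD2 (gnormZ_le a pe) qe) _; rewrite lee_fin -/c.
  have c1 : c + 1 != 0 by rewrite gt_eqF// ltr_wpDl.
  have -> : 2 * (c * (e / (4 * (c + 1))) + e / 4) =
      e - e / (2 * (c + 1)) by field.
  by rewrite gerBl divr_ge0 ?(ltW e0)// mulr_ge0// addr_ge0.
- move=> f g /in_ballA[fH fp] /in_ballA[gH gp]; apply/in_ballA.
  split; first exact: HM.
  move=> e e0.
  have /in_Hinf[_ fb] := fH; have /in_Hinf[_ gb] := gH.
  set a := fine (gnorm f); set b := fine (gnorm g).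
  have a0 : 0 <= a by rewrite fine_ge0// gnorm_ge0.
  have b0 : 0 <= b by rewrite fine_ge0// gnorm_ge0.
  have [|q qe] := gp (Num.min 1 (e / (4 * (a + 1)))).
    by rewrite lt_min ltr01 divr_gt0// mulr_gt0// ltr_wpDl.
  set q' := ncpoly_map q in qe.
  have qb : (gnorm q' <= (2 * (b + 1))%:E)%E.
    have -> : q' = g + -1 *: (g - q') by rewrite scaleN1r opprB addrC subrK.
    apply: le_trans (gnormD2 (gnorm_fin gb) (gnormZ_le (-1) qe)) _.
    rewrite lee_fin ler_pM2l// lerD2l normrN1 /= mul1r.
    by rewrite ge_min lexx.
  have [|p pe] := fp (e / (4 * (2 * (b + 1)))).
    by rewrite divr_gt0// !mulr_gt0// ltr_wpDl.
  exists [seq (t.1 * u.1, t.2 ++ u.2) | t <- p, u <- q].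
  rewrite ncpoly_mapM -/q'.
  have -> : f * g - ncpoly_map p * q' =
      f * (g - q') + (f - ncpoly_map p) * q'.
    by rewrite mulrBr mulrBl addrA subrK.
  have qe' : (gnorm (g - q') <= (e / (4 * (a + 1)))%:E)%E.
    by apply: le_trans qe _; rewrite lee_fin ge_min lexx orbT.
  apply: le_trans (gnormD2 (gnormM_le (gnorm_fin fb) qe') (gnormM_le pe qb)) _.
  rewrite lee_fin -/a -/b.
  have a1 : a + 1 != 0 by rewrite gt_eqF// ltr_wpDl.
  have b1 : b + 1 != 0 by rewrite gt_eqF// ltr_wpDl.
  have -> : 2 * (a * (e / (4 * (a + 1))) +
      e / (4 * (2 * (b + 1))) * (2 * (b + 1))) =
      e - e / (2 * (a + 1)) by field; rewrite b1 a1.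
  by rewrite gerBl divr_ge0 ?(ltW e0)// mulr_ge0// addr_ge0.
Qed.

HB.instance Definition _ := GRing.isSubalgClosed.Build C gmap Hinf
  (GRing.subalg_closed_semi Hinf_subalg).
HB.instance Definition _ := GRing.isSubalgClosed.Build C gmap ballA
  (GRing.subalg_closed_semi ballA_subalg).

End OperatorBall.

Arguments gnorm {R H K d Q} f%_R.
Arguments ncball {R H K d} Q n _.
Arguments cncball {R H K d} Q n _.
Arguments Hinf {R H K d} Q _.
Arguments ballA {R H K d} Q _.
Arguments gcoord {R H K d} Q j n X.

Section Representations.
Context {R : realType} {H K : completeNormedModType R[i]} {d : nat}.
Context {Q : 'I_d -> {linear H -> K}}.
Variable A : subalgClosed (gmap Q).
Local Notation C := R[i].

Definition fun_alg : Type := {f : gmap Q | f \in A}.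

HB.instance Definition _ := SubChoice.copy fun_alg {f : gmap Q | f \in A}.
HB.instance Definition _ := [SubChoice_isSubAlgebra of fun_alg by <:].

Definition completely_contractive (n : nat) (Phi : fun_alg -> 'M[C]_n) : Prop :=
  forall (k : nat) (F : 'I_k -> 'I_k -> fun_alg),
    (mxnorm (\mxblock_(i < k, j < k) Phi (F i j))
      <= gmatnorm (fun i j => val (F i j)))%E.

(* Rep_n^cc(A), with the topology of pointwise convergence on A *)
Definition repcc (n : nat) : set {ptws fun_alg -> 'M[C]_n} :=
  [set Phi | [/\ linear (Phi : fun_alg -> 'M[C]_n),
    GRing.monoid_morphism (Phi : fun_alg -> 'M[C]_n) &
    completely_contractive Phi]].

(* Phi |-> (Phi(Z_1), ..., Phi(Z_d)) *)
Definition evalat (Z : 'I_d -> fun_alg) (n : nat)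
    (Phi : {ptws fun_alg -> 'M[C]_n}) : mxtuple R d n := fun j => Phi (Z j).

End Representations.

Arguments repcc {R H K d Q} A n _.
Arguments evalat {R H K d Q A} Z n Phi.

Section BoundedPointwise.
Context {R : realType} {H K : completeNormedModType R[i]} {d : nat}.
Variable Q : 'I_d -> {linear H -> K}.

(* H^oo with the bounded-pointwise topology, i.e. the topology determined by
   the requirement that bounded nets converge exactly when they converge
   pointwise (see bp_cvgP): a set is open when every bounded net converging
   pointwise to one of its points is eventually in it. Equivalently, its trace
   on each ball of H^oo is relatively open for pointwise convergence, as for the
   bounded weak-* topology. Nets are replaced by filters.
   By construction this is the finest topology with the required property. The
   one with the fewest open sets is useless here: its proper closed sets are
   the bounded sets closed for pointwise convergence, so that for d > 0 no
   unital representation is continuous for it. Continuity for the topology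
   below means that bounded pointwise-convergent nets are sent to convergent
   ones (bp_continuousP). *)
Definition bpHinf : Type := fun_alg (Hinf Q).
HB.instance Definition _ := Choice.on bpHinf.

Definition bounded_net (F : set_system bpHinf) : Prop :=
  exists M : R, F [set g | (gnorm (val g) <= M%:E)%E].

Definition pointwise_cvg (F : set_system bpHinf) (f : bpHinf) : Prop :=
  forall n (X : ncball Q n), val g n X @[g --> F] --> val f n X.

Definition bp_open (U : set bpHinf) : Prop :=
  forall (F : set_system bpHinf) (f : bpHinf), ProperFilter F ->
    bounded_net F -> pointwise_cvg F f -> U f -> F U.

Let bp_openT : bp_open setT.
Proof. by move=> F f FF _ _ _; exact: filterT. Qed.
Let bp_openI : setI_closed bp_open.
Proof.
move=> U V oU oV F f FF Fb Ff [Uf Vf].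
by apply: filterI; [exact: oU Ff Uf|exact: oV Ff Vf].
Qed.
Let bp_open_bigU (I : Type) (U : I -> set bpHinf) :
  (forall i, bp_open (U i)) -> bp_open (\bigcup_i U i).
Proof.
move=> oU F f FF Fb Ff [i _ Uif].
by apply: filterS (oU i F f FF Fb Ff Uif) => g; exists i.
Qed.
HB.instance Definition _ :=
  isOpenTopological.Build bpHinf bp_openT bp_openI bp_open_bigU.

Lemma bp_openE : (open : set_system bpHinf) = bp_open.
Proof. by []. Qed.

Lemma Re_continuous : continuous (fun z : R[i] => complex.Re z).
Proof.
move=> z; apply/(@cvgrPdist_lt R R^o _ _ (nbhs_filter z)) => e e0.
have eC : 0 < e%:C by rewrite ltcR.
near=> w.
have zw : `|z - w| < e%:C.
  by near: w; apply: (@cvgr_dist_lt R[i] R[i]) eC; exact: cvg_id.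
rewrite -ltcR; apply: le_lt_trans zw; rewrite -raddfB.
exact: normc_ge_Re.
Unshelve. all: by end_near.
Qed.

Lemma l2norm_mxapp_continuous m n (v : 'I_n -> R[i]) :
  continuous (fun A : 'M[R[i]]_(m, n) => l2norm (mxapp A v)).
Proof.
have cv i : continuous (fun A : 'M[R[i]]_(m, n) => mxapp A v i).
  apply: (@continuous_big _ _ +%R); first exact: add_continuous.
  move=> k _ A; apply: continuousM; last exact: cst_continuous.
  exact: coord_continuous.
have cs : continuous (fun A : 'M[R[i]]_(m, n) =>
    \sum_i (complex.Re `|mxapp A v i|) ^+ 2).
  apply: (@continuous_big _ _ +%R); first exact: add_continuous.
  move=> i _ A.
  apply: (@continuous_comp _ _ _ (fun B => complex.Re `|mxapp B v i|)
    (fun x : R => x ^+ 2)); last exact: exprn_continuous.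
  apply: (@continuous_comp _ _ _ (fun B => `|mxapp B v i|) (@complex.Re R)).
    2: exact: Re_continuous.
  apply: (@continuous_comp _ _ _ (fun B => mxapp B v i) Num.norm).
    exact: cv.
  exact: norm_continuous.
move=> A; apply: (@continuous_comp _ _ _ (fun B : 'M[R[i]]_(m, n) =>
  \sum_i (complex.Re `|mxapp B v i|) ^+ 2) Num.sqrt); first exact: cs.
exact: sqrt_continuous.
Qed.

Lemma bp_cvgP (F : set_system bpHinf) (f : bpHinf) :
  ProperFilter F -> bounded_net F -> F --> f <-> pointwise_cvg F f.
Proof.
move=> FF Fb; split=> [Ff n X N Nf|Ff U [V [oV Vf VU]]]; last first.
  by apply: filterS VU _; exact: oV Ff Vf.
case: Fb => M FM.
pose U : set bpHinf :=
  [set g | N^° (val g n X) \/ ~ (gnorm (val g) <= M%:E)%E].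
have oU : bp_open U.
  move=> G g GG _ Gg [Ng|gM].
    have GN : G [set h | N^° (val h n X)] := Gg n X _ (nbhs_interior Ng).
    by apply: filterS GN => h; left.
  have [m [Y [v v1 gv]]] : exists m (Y : ncball Q m),
      exists2 v, l2norm v <= 1 & M < l2norm (mxapp (val g m Y) v).
    apply: contra_notP gM => ng; apply/gnorm_leP => m Y.
    apply/opnorm_leP => v v1; rewrite lee_fin leNgt; apply/negP => gv.
    by apply: ng; exists m, Y, v.
  have GM : G [set h | M < l2norm (mxapp (val h m Y) v)].
    have := cvg_comp _ _ (Gg m Y) (@l2norm_mxapp_continuous _ _ v (val g m Y)).
    by move=> /(_ [set r | M < r]); apply; exact: lt_nbhsr gv.
  apply: filterS GM => h /= hv; right => /gnorm_leP /(_ m Y) /opnorm_leP /(_ v v1).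
  by rewrite lee_fin leNgt hv.
have FU : F U.
  by apply: Ff; exists U; split=> //; left.
suff : F (fun g => N (val g n X)) by [].
by apply: filterS2 FM FU => g gM; case=> // /interior_subset.
Qed.

Lemma bp_continuousP (T : topologicalType) (Phi : bpHinf -> T) :
  continuous Phi <->
  (forall (F : set_system bpHinf) (f : bpHinf), ProperFilter F ->
    bounded_net F -> pointwise_cvg F f -> Phi @ F --> Phi f).
Proof.
split=> [cPhi F f FF Fb Ff|Phic].
  have cFf : F --> f by apply/bp_cvgP.
  exact: cvg_comp cFf (cPhi f).
apply/continuousP => V oV; rewrite bp_openE => F f FF Fb Ff Vf.
by apply: (Phic F f FF Fb Ff); exact: open_nbhs_nbhs.
Qed.

End BoundedPointwise.

(* f restricts to a homeomorphism of A onto B, for the subspace topologies. *)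
Definition homeo_on (S T : topologicalType) (A : set S) (B : set T)
    (f : S -> T) : Prop :=
  {within A, continuous f} /\
  exists g : T -> S, [/\ {within B, continuous g},
    forall x, A x -> B (f x), forall y, B y -> A (g y),
    forall x, A x -> g (f x) = x & forall y, B y -> f (g y) = y].

(* Main.v *)
(* A completely contractive representation is contractive on the matrices of
   linear forms obtained by compressing Q(Z) to finite dimensional subspaces, so
   pi maps into the closed ball. Conversely a point X of the closed ball carries
   the representation f |-> lim f(rX), the limit being taken along an ultrafilter
   as r tends to 1. On the ball algebra, density of the polynomials gives
   injectivity, and f(X) is a uniform limit of continuous functions of X.

   On H^oo one needs polynomials converging to f boundedly and pointwise. For the
   nilpotent shift N of size m, f(X (x) N) is a polynomial in X (x) N, because f
   respects intertwiners with creation operators on words. The average of its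
   blocks is a polynomial in X, bounded by ||f||: it is the Fejer mean of the
   Taylor-Taylor series of f. It is O(m^{-1/2}) close to f(X), uniformly for
   ||Q(X)|| <= r < 1. Hence f is continuous on each level of the ball, and a
   bounded-pointwise continuous representation over X is the evaluation at X. *)

Require Import Defs.
From HB Require Import structures.
From mathcomp Require Import all_boot all_order all_algebra.
From mathcomp Require Import all_classical all_reals all_analysis.
From mathcomp Require Import ring lra.

Set Implicit Arguments.
Unset Strict Implicit.
Unset Printing Implicit Defensive.

Import Defs Order.TTheory GRing.Theory Num.Theory numFieldNormedType.Exports.

Local Open Scope classical_set_scope.
Local Open Scope ring_scope.
Local Open Scope complex_scope.

(** * Operator norms and nc functions *)

Section HilbertSum.
Context {R : realType}.
Local Notation C := R[i].
Implicit Types V W : normedModType C.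

(** Squared norms add up over blocks of indices, so most norm bounds below are proved in squared
    form. *)
Lemma ler_l2norm V W n m (v : 'I_n -> V) (w : 'I_m -> W) (c : R) : 0 <= c ->
  (l2norm v <= c * l2norm w) = (l2norm v ^+ 2 <= c ^+ 2 * l2norm w ^+ 2).
Proof.
by move=> c0; rewrite -exprMn ler_pXn2r// nnegrE ?mulr_ge0// l2norm_ge0.
Qed.

Lemma l2norm_split V n m (v : 'I_(n + m) -> V) :
  l2norm v ^+ 2 =
    l2norm (v \o lshift m) ^+ 2 + l2norm (v \o @rshift n m) ^+ 2.
Proof. by rewrite !l2norm_sqr big_split_ord. Qed.

(** [tagnat.Rank a i] is the flat position of index [i] of block [a]; the block computations below
    go through this reindexing. *)
Lemma sum_Rank (T : nmodType) k (p : 'I_k -> nat)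
    (F : 'I_(\sum_i p i)%N -> T) :
  \sum_s F s = \sum_a \sum_i F (tagnat.Rank a i).
Proof.
rewrite sig_big_dep/= (reindex _ tagnat.sig_bij_on)/=.
by apply: eq_bigr => s _; rewrite tagnat.sig2K.
Qed.

Lemma l2norm_Rank V k (p : 'I_k -> nat) (v : 'I_(\sum_i p i)%N -> V) :
  l2norm v ^+ 2 = \sum_a l2norm (fun i => v (tagnat.Rank a i)) ^+ 2.
Proof.
by rewrite l2norm_sqr sum_Rank; apply: eq_bigr => a _; rewrite l2norm_sqr.
Qed.

Lemma mxblock_Rank (T : Type) p q (p_ : 'I_p -> nat) (q_ : 'I_q -> nat)
    (B : forall i j, 'M[T]_(p_ i, q_ j)) a i b j :
  (\mxblock_(i, j) B i j) (tagnat.Rank a i) (tagnat.Rank b j) = B a b i j.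
Proof. by have /matrixP/(_ i j) := mxblockK B a b; rewrite !mxE. Qed.

Lemma mxapp_mxblock p q (p_ : 'I_p -> nat) (q_ : 'I_q -> nat)
    (B : forall i j, 'M[C]_(p_ i, q_ j)) v a i :
  mxapp (\mxblock_(i, j) B i j) v (tagnat.Rank a i) =
  \sum_b mxapp (B a b) (fun j => v (tagnat.Rank b j)) i.
Proof.
rewrite /mxapp sum_Rank; apply: eq_bigr => b _; apply: eq_bigr => j _.
by rewrite mxblock_Rank.
Qed.

Lemma Re_norm_le V (x : V) (c : R) :
  (complex.Re `|x| <= c) = (`|x| <= c%:C).
Proof. by rewrite -[in RHS]Re_norm lecR. Qed.

Lemma l2norm_coord V n (v : 'I_n -> V) i : complex.Re `|v i| <= l2norm v.
Proof.
rewrite -(@ler_pXn2r _ 2)// ?nnegrE ?Re_norm_ge0 ?l2norm_ge0//.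
rewrite l2norm_sqr (bigD1 i)//= lerDl sumr_ge0// => j _; exact: sqr_ge0.
Qed.

Lemma l2norm_delta n (j : 'I_n) : l2norm (fun i => (i == j)%:R : C) = 1.
Proof.
have h (b : bool) : complex.Re `|b%:R : C| ^+ 2 = b%:R.
  by case: b; rewrite ?normr1 ?normr0 ?expr1n ?expr0n.
rewrite /l2norm; under eq_bigr do rewrite h.
rewrite (bigD1 j)//= eqxx big1 ?addr0 ?sqrtr1// => i /negbTE -> //.
Qed.

Lemma mxnorm_entry m n (A : 'M[C]_(m, n)) (c : R) i j :
  (mxnorm A <= c%:E)%E -> `|A i j| <= c%:C.
Proof.
move=> /mxnorm_leP[c0 /(_ (fun k => (k == j)%:R))].
rewrite l2norm_delta mulr1 => Ac.
rewrite -Re_norm_le; apply: le_trans Ac.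
have -> : A i j = mxapp A (fun k => (k == j)%:R) i.
  rewrite /mxapp (bigD1 j)//= eqxx mulr1 big1 ?addr0// => k /negbTE ->.
  by rewrite mulr0.
exact: l2norm_coord.
Qed.

End HilbertSum.

(** * The operator Q(X), and intertwiners of nc functions *)

Section Operators.
Context {R : realType} {H K : completeNormedModType R[i]} {d : nat}.
Variable Q : 'I_d -> {linear H -> K}.
Local Notation C := R[i].

Lemma ncop_scale n (X : mxtuple R d n) (a : C) (v : 'I_n -> H) :
  ncop Q X (fun k => a *: v k) = fun i => a *: ncop Q X v i.
Proof.
apply/funext => i; rewrite /ncop scaler_sumr; apply: eq_bigr => j _.
rewrite scaler_sumr; apply: eq_bigr => k _.
by rewrite linearZ !scalerA mulrC.
Qed.

Lemma ncopZ n (X : mxtuple R d n) (a : C) (v : 'I_n -> H) :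
  ncop Q (fun j => a *: X j) v = fun i => a *: ncop Q X v i.
Proof.
apply/funext => i; rewrite /ncop scaler_sumr; apply: eq_bigr => j _.
by rewrite scaler_sumr; apply: eq_bigr => k _; rewrite mxE scalerA.
Qed.

Lemma ncopB n (X Y : mxtuple R d n) (v : 'I_n -> H) :
  ncop Q X v = fun i => ncop Q Y v i + ncop Q (fun j => X j - Y j) v i.
Proof.
apply/funext => i; rewrite /ncop -big_split/=; apply: eq_bigr => j _.
rewrite -big_split/=; apply: eq_bigr => k _.
by rewrite -scalerDl; congr (_ *: _); rewrite !mxE; ring.
Qed.

Lemma ncop0 n (X : mxtuple R d n) : ncop Q X (fun=> 0) = fun=> 0.
Proof.
apply/funext => i; rewrite /ncop big1// => j _; rewrite big1// => k _.
by rewrite linear0 scaler0.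
Qed.

(** Homogeneous, real-valued form of a bound on the operator norm: no extended reals and no
    normalised vectors. *)
Definition ncop_le n (X : mxtuple R d n) (r : R) : Prop :=
  forall v : 'I_n -> H, l2norm (ncop Q X v) <= r * l2norm v.

Lemma ncop_leP n (X : mxtuple R d n) (r : R) : 0 <= r ->
  (opnorm (ncop Q X) <= r%:E)%E <-> ncop_le X r.
Proof.
move=> r0; split=> [Xr v|Xr]; last first.
  apply/opnorm_leP => v v1; rewrite lee_fin (le_trans (Xr v))//.
  by rewrite -[leRHS]mulr1 ler_wpM2l.
have [v0|v0] := eqVneq (l2norm v) 0.
  by rewrite (l2norm_eq0 v0) ncop0 !l2norm0 mulr0.
have vp : 0 < l2norm v by rewrite lt_neqAle eq_sym v0 l2norm_ge0.
have ReV : complex.Re `|((l2norm v)^-1)%:C| = (l2norm v)^-1.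
  by rewrite ger0_norm// lecR invr_ge0 ltW.
move/opnorm_leP : Xr => /(_ (fun k => ((l2norm v)^-1)%:C *: v k)).
rewrite ncop_scale !l2normZ ReV mulVf// lexx lee_fin => /(_ isT).
by rewrite ler_pdivrMl// mulrC.
Qed.

Lemma ncop_le_trans n (X : mxtuple R d n) (r s : R) : r <= s ->
  ncop_le X r -> ncop_le X s.
Proof.
by move=> rs Xr v; rewrite (le_trans (Xr v))// ler_wpM2r// l2norm_ge0.
Qed.

Lemma opnorm_ncop_ge0 n (X : mxtuple R d n) : (0 <= opnorm (ncop Q X))%E.
Proof.
apply: ereal_sup_ubound; exists (fun=> 0); first by rewrite /= l2norm0.
by rewrite ncop0 l2norm0.
Qed.

(** The open ball is used through an explicit radius [r < 1], on which the Fejer estimate depends;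
    the norm itself serves as [r]. *)
Lemma ncballP n (X : mxtuple R d n) : ncball Q n X <->
  (0 < n)%N /\ exists r, [/\ 0 <= r, r < 1 & ncop_le X r].
Proof.
split=> -[n0 X1]; split=> //; last first.
  case: X1 => r [r0 r1 /(ncop_leP X r0) Xr].
  by apply: le_lt_trans Xr _; rewrite lte_fin.
have X0 := opnorm_ncop_ge0 X.
have Xf : opnorm (ncop Q X) \is a fin_num.
  by rewrite ge0_fin_numE// (lt_trans X1)// ltry.
exists (fine (opnorm (ncop Q X))); split; first exact: fine_ge0.
  by rewrite -lte_fin fineK.
by apply/ncop_leP; rewrite ?fine_ge0// fineK.
Qed.

Lemma cncballP n (X : mxtuple R d n) :
  cncball Q n X <-> (0 < n)%N /\ ncop_le X 1.
Proof. by split=> -[n0 X1]; split=> //; exact/(ncop_leP X ler01). Qed.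

Definition pt n (X : mxtuple R d n) (XB : ncball Q n X) : ncball Q n :=
  SigSub (mem_set XB).

Lemma ptP n (X : ncball Q n) : ncball Q n (val X).
Proof. exact: set_valP. Qed.

Lemma ncop_leZ n (X : mxtuple R d n) (a : C) (r : R) :
  ncop_le X r -> ncop_le (fun j => a *: X j) (complex.Re `|a| * r).
Proof.
by move=> Xr v; rewrite ncopZ l2normZ -mulrA ler_wpM2l// (@Re_norm_ge0 R C).
Qed.

(** The two halves of [v] are acted on separately, and squared norms add. *)
Lemma ncop_le_dsum n m (X : mxtuple R d n) (Y : mxtuple R d m) (r : R) :
  0 <= r -> ncop_le X r -> ncop_le Y r ->
  ncop_le (fun j => block_mx (X j) 0 0 (Y j)) r.
Proof.
move=> r0 Xr Yr v; rewrite ler_l2norm//.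
set Z := fun j => block_mx (X j) 0 0 (Y j).
have ZX : ncop Q Z v \o lshift m = ncop Q X (v \o lshift m).
  apply/funext => i; rewrite /ncop /=; apply: eq_bigr => j _.
  rewrite big_split_ord/= [X in _ + X]big1 => [|k _].
    by rewrite addr0; apply: eq_bigr => k _; rewrite block_mxEul.
  by rewrite block_mxEur mxE scale0r.
have ZY : ncop Q Z v \o @rshift n m = ncop Q Y (v \o @rshift n m).
  apply/funext => i; rewrite /ncop /=; apply: eq_bigr => j _.
  rewrite big_split_ord/= [X in X + _]big1 => [|k _].
    by rewrite add0r; apply: eq_bigr => k _; rewrite block_mxEdr.
  by rewrite block_mxEdl mxE scale0r.
by rewrite !l2norm_split ZX ZY mulrDr lerD// -ler_l2norm.
Qed.

Lemma ncball_dsum n m (X : ncball Q n) (Y : ncball Q m) :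
  ncball Q (n + m)%N (fun j => block_mx (val X j) 0 0 (val Y j)).
Proof.
have /ncballP[n0 [r [r0 r1 Xr]]] := ptP X.
have /ncballP[m0 [s [s0 s1 Ys]]] := ptP Y.
apply/ncballP; split; first by rewrite addn_gt0 n0.
exists (Num.max r s); split; first by rewrite le_max r0.
  by rewrite gt_max r1.
apply: ncop_le_dsum; first by rewrite le_max r0.
- by apply: ncop_le_trans Xr; rewrite le_max lexx.
- by apply: ncop_le_trans Ys; rewrite le_max lexx orbT.
Qed.

(* The standard nc argument: [W] intertwines [X] and [Y] iff the direct sum of
   [X] and [Y] commutes with the unipotent matrix with corner [W]. *)
Lemma nc_intertwine (f : gmap Q) n m (X : ncball Q n) (Y : ncball Q m)
    (W : 'M[C]_(n, m)) : nc_function f ->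
  (forall j, val X j *m W = W *m val Y j) -> f n X *m W = W *m f m Y.
Proof.
move=> [fs fc] XW; pose Z := pt (ncball_dsum X Y).
have fZ : f _ Z = block_mx (f n X) 0 0 (f m Y) by exact: fs.
pose S : 'M[C]_(n + m) := block_mx 1%:M W 0 1%:M.
pose S' : 'M[C]_(n + m) := block_mx 1%:M (- W) 0 1%:M.
have SS' : S *m S' = 1%:M.
  rewrite mulmx_block !(mul1mx, mulmx1, mul0mx, mulmx0, addr0, add0r).
  by rewrite addNr -scalar_mx_block.
have Su : S \in unitmx by exact: (proj1 (mulmx1_unit SS')).
have ZS j : val Z j *m S = S *m val Z j.
  rewrite !mulmx_block !(mul1mx, mulmx1, mul0mx, mulmx0, addr0, add0r).
  by rewrite XW.
have h : f _ Z = invmx S *m f _ Z *m S.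
  by apply: fc => // j; rewrite -mulmxA ZS mulmxA mulVmx// mul1mx.
have : S *m f _ Z = f _ Z *m S.
  by rewrite {1}h !mulmxA mulmxV// mul1mx.
rewrite fZ !mulmx_block !(mul1mx, mulmx1, mul0mx, mulmx0, addr0, add0r).
by move=> /eq_block_mx[_ <-].
Qed.

(** Kronecker product. The dimension is kept as a sum of copies of [n], the shape that the block
    matrix operations expect. *)
Definition kron p q n m (M : 'M[C]_(p, q)) (A : 'M[C]_(n, m)) :
  'M[C]_(\sum_(i < p) n, \sum_(i < q) m)%N := \mxblock_(i, j) (M i j *: A).

Lemma kron_mul p q r n m l (M : 'M[C]_(p, q)) (N : 'M[C]_(q, r))
    (A : 'M[C]_(n, m)) (B : 'M[C]_(m, l)) :
  kron M A *m kron N B = kron (M *m N) (A *m B).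
Proof.
rewrite /kron mul_mxblock; apply: eq_mxblock => i j.
rewrite mxE scaler_suml; apply: eq_bigr => k _.
by rewrite -scalemxAl -scalemxAr scalerA.
Qed.

Lemma ncop_kron p n (M : 'M[C]_p) (X : mxtuple R d n)
    (v : 'I_(\sum_(a < p) n)%N -> H) a i :
  ncop Q (fun j => kron M (X j)) v (tagnat.Rank a i) =
  \sum_b M a b *: ncop Q X (fun i => v (tagnat.Rank b i)) i.
Proof.
rewrite /ncop.
under [RHS]eq_bigr do rewrite scaler_sumr.
rewrite [RHS]exchange_big; apply: eq_bigr => j _ /=.
rewrite sum_Rank; apply: eq_bigr => b _; rewrite scaler_sumr.
by apply: eq_bigr => k _; rewrite /kron mxblock_Rank mxE scalerA.
Qed.

End Operators.
Arguments pt {R H K d Q n X}.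

(** * Polynomial approximation of bounded nc functions *)

Section WordSeries.
Context {R : realType} {H K : completeNormedModType R[i]} {d : nat}.
Variable Q : 'I_d -> {linear H -> K}.
Local Notation C := R[i].

Definition wordprod n (X : mxtuple R d n) (w : seq 'I_d) : 'M[C]_n :=
  \prod_(j <- w) (X j : 'M[C]_n).

(** Unlike [ncpoly_map], this makes sense at every tuple, in particular at boundary points of the
    ball. *)
Definition polyeval (p : @ncpoly R d) n (X : mxtuple R d n) : 'M[C]_n :=
  \sum_(t <- p) t.1 *: wordprod X t.2.

Lemma wordprod_cons n (X : mxtuple R d n) j w :
  wordprod X (j :: w) = X j *m wordprod X w.
Proof. exact: big_cons. Qed.

Lemma gmap_sum n (X : ncball Q n) (I : Type) (s : seq I) (F : I -> gmap Q) :
  (\sum_(i <- s) F i) n X = \sum_(i <- s) F i n X.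
Proof. exact: (big_morph (fun f : gmap Q => f n X)). Qed.

Lemma ncpoly_mapE (p : @ncpoly R d) n (X : ncball Q n) :
  ncpoly_map p X = polyeval p (val X).
Proof.
rewrite /ncpoly_map gmap_sum; apply: eq_bigr => t _; congr (_ *: _).
exact: (big_morph (fun f : gmap Q => (f n X : 'M[C]_n))).
Qed.

Hypothesis Q_cont : forall j, continuous (Q j).

(** Continuous linear maps are bounded, and the sum of the finitely many bounds serves for all
    [j]. *)
Lemma Q_bounded : exists2 B : R, 0 <= B &
  forall j x, complex.Re `|Q j x| <= B * complex.Re `|x|.
Proof.
have /choice[B BP] (j : 'I_d) : exists B : R, 0 <= B /\
    forall x, complex.Re `|Q j x| <= B * complex.Re `|x|.
  have /linear_boundedP : bounded_near (Q j) (nbhs 0).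
    exact/linear_bounded_continuous.
  move=> /pinfty_ex_gt0[M M0 QM]; exists (complex.Re M).
  have MC : M = (complex.Re M)%:C by rewrite RRe_real// gtr0_real.
  split; first by move: M0; rewrite MC ltcR => /ltW.
  by move=> x; have := QM x; rewrite {1}MC -(Re_norm x) -(Re_norm (Q j x)) -rmorphM lecR.
exists (\sum_j B j) => [|j x]; first by apply: sumr_ge0 => j _; have [] := BP j.
have [_ /(_ x)/le_trans] := BP j; apply; rewrite ler_wpM2r ?Re_norm_ge0//.
by rewrite (bigD1 j)//= lerDl sumr_ge0// => k _; have [] := BP k.
Qed.

Definition entry_sum n (X : mxtuple R d n) : R :=
  \sum_i \sum_j \sum_k complex.Re `|X j i k|.

Lemma entry_sum_ge0 n (X : mxtuple R d n) : 0 <= entry_sum X.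
Proof.
by do 3![apply: sumr_ge0 => ? _]; exact: (@Re_norm_ge0 R C).
Qed.

Lemma Re_norm_sum (V : normedModType C) (I : Type) (s : seq I) (F : I -> V) :
  complex.Re `|\sum_(i <- s) F i| <= \sum_(i <- s) complex.Re `|F i|.
Proof.
elim/big_rec2: _ => [|i x y _ xy]; first by rewrite normr0.
by apply: le_trans (Re_normD _ _) _; rewrite lerD2l.
Qed.

(** A crude estimate by the triangle inequality in each row, the l2 norm being at most the l1 norm.
    It makes the ball absorbing ([ncball_scale]) and open at each level ([ncop_le_near]). *)
Lemma ncop_le_entry : exists2 B : R, 0 <= B &
  forall n (X : mxtuple R d n), ncop_le Q X (B * entry_sum X).
Proof.
have [B B0 QB] := Q_bounded; exists B => // n X v.
pose S i := \sum_j \sum_k complex.Re `|X j i k|.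
have S0 i : 0 <= S i.
  by do 2![apply: sumr_ge0 => ? _]; exact: (@Re_norm_ge0 R C).
have XS i : complex.Re `|ncop Q X v i| <= S i * (B * l2norm v).
  apply: le_trans (Re_norm_sum _ _) _; rewrite mulr_suml ler_sum// => j _.
  apply: le_trans (Re_norm_sum _ _) _; rewrite mulr_suml ler_sum// => k _.
  rewrite Re_normZ ler_wpM2l ?(@Re_norm_ge0 R C)//.
  by apply: le_trans (QB _ _) _; rewrite ler_wpM2l// l2norm_coord.
rewrite ler_l2norm ?mulr_ge0 ?entry_sum_ge0// -exprMn l2norm_sqr.
have -> : B * entry_sum X * l2norm v = \sum_i S i * (B * l2norm v).
  by rewrite -mulr_suml -/(entry_sum X) mulrA (mulrC _ B).
have sqs (I : finType) (F : I -> R) : (forall i, 0 <= F i) ->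
    \sum_i F i ^+ 2 <= (\sum_i F i) ^+ 2.
  move=> F0; rewrite expr2 mulr_suml ler_sum// => i _.
  rewrite expr2 ler_wpM2l// (bigD1 i)//= lerDl sumr_ge0//.
apply: le_trans (sqs _ _ _) => [|i]; last by rewrite !mulr_ge0 ?l2norm_ge0.
by apply: ler_sum => i _; rewrite lerXn2r ?nnegrE ?Re_norm_ge0 ?mulr_ge0 ?l2norm_ge0.
Qed.

Lemma ncball_scale n (X : mxtuple R d n) : (0 < n)%N ->
  exists2 e : R, 0 < e & ncball Q n (fun j => e%:C *: X j).
Proof.
move=> n0; have [B B0 QB] := ncop_le_entry.
set b := B * entry_sum X; have b0 : 0 <= b by rewrite mulr_ge0 ?entry_sum_ge0.
have e0 : 0 < (1 + b)^-1 by rewrite invr_gt0 ltr_pwDl.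
(* Adding 1 covers the case [b = 0] and keeps the new radius [b / (1 + b)] below 1. *)
exists (1 + b)^-1 => //; apply/ncballP; split=> //.
exists ((1 + b)^-1 * b); split; first by rewrite mulr_ge0// ltW.
  by rewrite mulrC ltr_pdivrMr ?ltr_pwDl// mul1r ltrDr.
have := ncop_leZ (1 + b)^-1%:C (QB _ X).
by rewrite ger0_norm ?lecR ?(ltW e0).
Qed.

(* Let [L] be the creation operators on words of length at most [m]. If all
   words of length [m + 1] vanish at [Y], then the matrices [w |-> Y^w xi]
   intertwine [Y] and [L], so that the series of [f] can be read off the value
   of [f] at [e L] on the empty word. The factor [e] brings [L] into the ball. *)
Lemma nc_wordseries (f : gmap Q) (m : nat) : nc_function f ->
  exists c : m.-bseq 'I_d -> C, forall n (Y : ncball Q n),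
    (forall w, size w = m.+1 -> wordprod (val Y) w = 0) ->
    f n Y = \sum_w c w *: wordprod (val Y) w.
Proof.
move=> fnc; pose I : finType := m.-bseq 'I_d; pose nilw : I := [bseq].
pose L : mxtuple R d #|I| := fun j => \matrix_(a, b)
  (val (enum_val a : I) == j :: val (enum_val b : I))%:R.
have [|e e0 eL] := @ncball_scale _ L; first by apply/card_gt0P; exists nilw.
pose P := pt eL; pose o := enum_rank nilw.
(* The coefficients are the column of [f (e L)] at the empty word; the power of [e] undoes the
   scaling of [L]. *)
exists (fun w : m.-bseq 'I_d =>
  (e%:C) ^- size w * f _ P (enum_rank (w : I)) o) => n Y Y0.
have eC0 : e%:C != 0 by rewrite gt_eqF// ltcR.
apply/matrixP => i k; rewrite summxE.
pose W : 'M[C]_(n, #|I|) := \matrix_(i, a)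
  ((e%:C) ^- size (enum_val a : I) * wordprod (val Y) (enum_val a : I) i k).
have YW j : val Y j *m W = W *m val P j.
  apply/matrixP => l b; rewrite mxE.
  have -> : \sum_a val Y j l a * W a b = (e%:C) ^- size (enum_val b : I) *
      wordprod (val Y) (j :: (enum_val b : I)) l k.
    rewrite wordprod_cons [in RHS]mxE mulr_sumr; apply: eq_bigr => a _.
    by rewrite mxE mulrCA.
  rewrite mxE; have [bm|bm] := ltnP (size (enum_val b : I)) m.
    pose w : I := Bseq (bm : (size (j :: (enum_val b : I)) <= m)%N).
    rewrite (bigD1 (enum_rank w))//= big1 => [|a aw].
      rewrite addr0 !mxE enum_rankK eqxx mulr1 /= exprS invfM.
      by rewrite [RHS]mulrC !mulrA mulfV// mul1r.
    rewrite !mxE; case: eqP => [aE|]; last by rewrite !mulr0.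
    by case/eqP: aw; rewrite -[a]enum_valK; congr enum_rank; apply: val_inj.
  (* At length [m] the word [j :: w] leaves the index set: the left side vanishes by [Y0], the right
     side because the column of [L j] is zero. *)
  rewrite Y0 ?mxE ?mulr0 => [|/=]; last first.
    by congr S; apply/eqP; rewrite eqn_leq bm andbT size_bseq.
  rewrite big1// => a _; rewrite !mxE; case: eqP => [aE|]; last by rewrite !mulr0.
  have := size_bseq (enum_val a : I); rewrite aE /= ltnNge => /negP; case.
  exact: bm.
(* Column [o] of [W], that of the empty word, is the basis vector of index [k], so the intertwining
   relation read there gives entry [(i, k)] of [f n Y]. *)
have /matrixP/(_ i o) := nc_intertwine fnc YW; rewrite !mxE.
rewrite (bigD1 k)//= big1 => [|a ak]; last first.
  by rewrite mxE enum_rankK/= /wordprod big_nil mxE (negbTE ak) !mulr0.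
rewrite addr0 !mxE enum_rankK /= /wordprod big_nil mxE eqxx expr0 invr1 !mulr1.
move=> ->; rewrite (reindex_onto enum_rank enum_val)/=; last first.
  by move=> a _; rewrite enum_valK.
rewrite (eq_bigl xpredT) => [|w]; last by rewrite enum_rankK eqxx.
by apply: eq_bigr => w _; rewrite !mxE enum_rankK mulrAC.
Qed.

End WordSeries.

(** * Block rows, block columns and weighted shifts *)

Section BlockOperators.
Context {R : realType} {H K : completeNormedModType R[i]} {d : nat}.
Variable Q : 'I_d -> {linear H -> K}.
Local Notation C := R[i].

(** Induction on the list. With partial sums [A], [B], [S], the bound [S ^+ 2 <= A * B] and the
    arithmetic-geometric inequality absorb the cross term [2 * S * x a * y a]; positivity of [A] and
    [B] is carried along for this. *)
Lemma CauchySchwarz_sum (I : Type) (s : seq I) (x y : I -> R) :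
  (\sum_(a <- s) x a * y a) ^+ 2 <=
  (\sum_(a <- s) x a ^+ 2) * (\sum_(a <- s) y a ^+ 2).
Proof.
suff [] : [/\ (\sum_(a <- s) x a * y a) ^+ 2 <=
    (\sum_(a <- s) x a ^+ 2) * (\sum_(a <- s) y a ^+ 2),
    0 <= \sum_(a <- s) x a ^+ 2 & 0 <= \sum_(a <- s) y a ^+ 2] by [].
elim/big_rec3: _ => [|a B A S _ [SAB A0 B0]].
  by rewrite expr0n mulr0.
split; rewrite ?addr_ge0 ?sqr_ge0//.
have t0 : 0 <= A * y a ^+ 2 + B * x a ^+ 2.
  by rewrite addr_ge0// mulr_ge0// sqr_ge0.
have h : 2 * S * x a * y a <= A * y a ^+ 2 + B * x a ^+ 2.
  apply: le_trans (ler_norm _) _.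
  rewrite -(@ler_pXn2r _ 2)// ?nnegrE// real_normK ?num_real//.
  have xy0 : 0 <= (x a * y a) ^+ 2 by exact: sqr_ge0.
  have := sqr_ge0 (A * y a ^+ 2 - B * x a ^+ 2).
  have := ler_wpM2r xy0 SAB.
  rewrite !expr2; nra.
nra.
Qed.

Lemma kron1 p n : kron (1%:M : 'M[C]_p) (1%:M : 'M[C]_n) = 1%:M.
Proof.
apply/mxblockP => a b; rewrite /kron mxblockK; apply/matrixP => i j.
rewrite !mxE (_ : (tagnat.Rank a i == tagnat.Rank b j) = (a == b) && (i == j)).
  by case: (a == b); rewrite ?mul1r ?mul0r.
exact: tagnat.eq_Rank.
Qed.

(** The operator [w (x) 1] from C^n to p copies of it; [krow] is its row analogue. Together they
    extract weighted sums of blocks. *)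
Definition kcol p n (w : 'I_p -> C) : 'M[C]_((\sum_(i < p) n)%N, n) :=
  \mxcol_(i < p) (w i)%:M.

Definition krow p n (u : 'I_p -> C) : 'M[C]_(n, (\sum_(i < p) n)%N) :=
  \mxrow_(i < p) (u i)%:M.

Lemma kcol_Rank p n (w : 'I_p -> C) a i k :
  kcol n w (tagnat.Rank a i) k = w a * (k == i)%:R.
Proof.
transitivity (submxcol (kcol n w) a i k); first by rewrite [RHS]mxE.
by rewrite mxcolK mxE eq_sym mulr_natr.
Qed.

Lemma krow_Rank p n (u : 'I_p -> C) a i k :
  krow n u i (tagnat.Rank a k) = u a * (k == i)%:R.
Proof.
transitivity (submxrow (krow n u) a i k); first by rewrite [RHS]mxE.
by rewrite mxrowK mxE eq_sym mulr_natr.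
Qed.

Lemma sum_delta n (c : C) (v : 'I_n -> C) i :
  \sum_k c * (k == i)%:R * v k = c * v i.
Proof.
rewrite (bigD1 i)//= big1 => [|k /negbTE ->]; last by rewrite mulr0 mul0r.
by rewrite eqxx mulr1 addr0.
Qed.

(** When [M] fixes [w], this makes [kcol n w] an intertwiner of [kron M A] and [A], as needed for
    [eshift] in [nc_fejer]. *)
Lemma kron_kcol p q n (M : 'M[C]_(p, q)) (A : 'M[C]_n) w :
  kron M A *m kcol n w = kcol n (fun a => \sum_b M a b * w b) *m A.
Proof.
rewrite /kron /kcol mul_mxblock_mxrow mxcol_mul; apply: eq_mxcol => a.
rewrite mul_scalar_mx scaler_suml; apply: eq_bigr => b _.
by rewrite -scalemxAl mul_mx_scalar scalerA.
Qed.

Lemma krow_kron p q n (M : 'M[C]_(p, q)) (A : 'M[C]_n) u :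
  krow n u *m kron M A = A *m krow n (fun b => \sum_a u a * M a b).
Proof.
rewrite /kron /krow mul_mxrow_mxblock mul_mxrow; apply: eq_mxrow => b.
rewrite mul_mx_scalar scaler_suml; apply: eq_bigr => a _.
by rewrite mul_scalar_mx scalerA.
Qed.

Lemma krow_kcol p n (u w : 'I_p -> C) :
  krow n u *m kcol n w = (\sum_a u a * w a)%:M.
Proof.
rewrite mul_mxrow_mxcol (raddf_sum (@scalar_mx C n)).
by apply: eq_bigr => a _; rewrite -scalar_mxM.
Qed.

Lemma kcolB p n (u w : 'I_p -> C) :
  kcol n u - kcol n w = kcol n (fun a => u a - w a).
Proof.
by rewrite /kcol -mxcolB; apply: eq_mxcol => a; rewrite -raddfB.
Qed.

Lemma mxnorm_kcol p n (w : 'I_p -> C) (c : R) : 0 <= c ->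
  \sum_a complex.Re `|w a| ^+ 2 <= c ^+ 2 -> (mxnorm (kcol n w) <= c%:E)%E.
Proof.
move=> c0 wc; apply/mxnorm_leP; split=> // v; rewrite ler_l2norm//.
rewrite l2norm_Rank; apply: le_trans (ler_wpM2r (sqr_ge0 _) wc).
rewrite mulr_suml ler_sum// => a _.
rewrite [X in l2norm X](_ : _ = fun i => w a *: v i).
  by rewrite l2normZ exprMn.
apply/funext => i; rewrite /mxapp -[RHS]sum_delta.
by apply: eq_bigr => k _; rewrite kcol_Rank.
Qed.

Lemma mxapp_krow p n (u : 'I_p -> C) v i :
  mxapp (krow n u) v i = \sum_a u a * v (tagnat.Rank a i).
Proof.
rewrite /mxapp sum_Rank; apply: eq_bigr => a _.
rewrite -(sum_delta _ (fun k => v (tagnat.Rank a k))).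
by apply: eq_bigr => k _; rewrite krow_Rank.
Qed.

(** Cauchy-Schwarz across the blocks, at each coordinate [i]. *)
Lemma mxnorm_krow p n (u : 'I_p -> C) (c : R) : 0 <= c ->
  \sum_a complex.Re `|u a| ^+ 2 <= c ^+ 2 -> (mxnorm (krow n u) <= c%:E)%E.
Proof.
move=> c0 uc; apply/mxnorm_leP; split=> // v; rewrite ler_l2norm//.
apply: le_trans (ler_wpM2r (sqr_ge0 _) uc).
rewrite l2norm_sqr l2norm_Rank.
under [X in _ <= _ * X]eq_bigr do rewrite l2norm_sqr.
rewrite [X in _ <= _ * X]exchange_big mulr_sumr ler_sum// => i _.
apply: le_trans (CauchySchwarz_sum _ _ _).
rewrite lerXn2r ?nnegrE ?(@Re_norm_ge0 R C)//.
  by apply: sumr_ge0 => a _; rewrite mulr_ge0 ?(@Re_norm_ge0 R C).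
rewrite [mxapp _ _ _](_ : _ = \sum_a u a * v (tagnat.Rank a i)).
  apply: le_trans (Re_norm_sum _ _) _; apply: ler_sum => a _.
  by rewrite (@Re_normZ R C).
exact: mxapp_krow.
Qed.

(** One nonzero entry at most per row, so that products reduce to composition with [s]; the
    truncated shift and its bordered version both have this form. *)
Definition wshift p (c : 'I_p -> R) (s : 'I_p -> 'I_p) : 'M[C]_p :=
  \matrix_(a, b) ((c a)%:C * (b == s a)%:R).

Lemma wshift_sum p (V : lmodType C) c (s : 'I_p -> 'I_p) (x : 'I_p -> V) a :
  \sum_b wshift c s a b *: x b = (c a)%:C *: x (s a).
Proof.
rewrite (bigD1 (s a))//= big1 => [|b /negbTE bs].
  by rewrite mxE eqxx mulr1 addr0.
by rewrite mxE bs mulr0 scale0r.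
Qed.

(** The hypothesis on [c] and [s] says that the weighted shift has norm at most [t], in terms of the
    squared norms [x b] of the blocks. *)
Lemma ncop_le_wshift p n (X : mxtuple R d n) (c : 'I_p -> R) s (r t : R) :
  0 <= r -> 0 <= t ->
  (forall x : 'I_p -> R, (forall b, 0 <= x b) ->
    \sum_a c a ^+ 2 * x (s a) <= t ^+ 2 * \sum_b x b) ->
  ncop_le Q X r -> ncop_le Q (fun j => kron (wshift c s) (X j)) (t * r).
Proof.
move=> r0 t0 ct Xr v; rewrite ler_l2norm ?mulr_ge0// 2!l2norm_Rank.
pose y b := l2norm (ncop Q X (fun i => v (tagnat.Rank b i))) ^+ 2.
rewrite (eq_bigr (fun a => c a ^+ 2 * y (s a))) => [|a _]; last first.
  rewrite /y [X in l2norm X](_ : _ = fun i =>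
    (c a)%:C *: ncop Q X (fun i => v (tagnat.Rank (s a) i)) i).
    by rewrite l2normZ exprMn normc_def/= expr0n addr0 sqrtr_sqr real_normK ?num_real.
  by apply/funext => i; rewrite ncop_kron wshift_sum.
apply: le_trans (ct y (fun b => sqr_ge0 _)) _.
rewrite exprMn -[leRHS]mulrA ler_wpM2l ?sqr_ge0// mulr_sumr ler_sum// => b _.
by rewrite /y -ler_l2norm.
Qed.

End BlockOperators.

(** * Fejer means of a bounded nc function *)

Section Fejer.
Context {R : realType} {H K : completeNormedModType R[i]} {d : nat}.
Variable Q : 'I_d -> {linear H -> K}.
Local Notation C := R[i].

(** The weight 0 in the last row cancels the default value that [inord] takes out of range. *)
Definition tshift m : 'M[C]_m.+1 :=
  wshift (fun a => (a < m)%N%:R) (fun a => inord a.+1).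

Lemma wshift_mul p q (c : 'I_p -> R) (s : 'I_p -> 'I_p) (A : 'M[C]_(p, q)) a b :
  (wshift c s *m A) a b = (c a)%:C * A (s a) b.
Proof. by rewrite mxE; exact: (@wshift_sum R p C^o). Qed.

(** In particular the power [m + 1] vanishes, so that [nc_wordseries] applies to X (x) N. *)
Lemma tshift_exp m k a b : (tshift m ^+ k) a b = (b == (a + k)%N :> nat)%:R.
Proof.
elim: k a => [|k IH] a; first by rewrite addn0 mxE eq_sym.
rewrite exprS wshift_mul IH; have [am|ma] := ltnP a m.
  by rewrite mul1r inordK ?ltnS// addSnnS.
rewrite mul0r; case: eqP => // bE; have := ltn_ord b.
by rewrite bE addnS ltnS ltnNge (leq_trans ma)// leq_addr.
Qed.

Lemma ncop_le_tshift m n (X : mxtuple R d n) (r : R) : 0 <= r ->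
  ncop_le Q X r -> ncop_le Q (fun j => kron (tshift m) (X j)) r.
Proof.
move=> r0 Xr; rewrite -[r]mul1r; apply: ncop_le_wshift => // x x0.
rewrite expr1n mul1r big_ord_recr/= ltnn expr0n mul0r addr0.
rewrite [leRHS]big_ord_recl/= ler_wpDl// ler_sum// => a _.
rewrite ltn_ord expr1n mul1r (_ : inord _ = lift ord0 a)//.
by apply: val_inj; rewrite /= inordK// ltnS.
Qed.

(* The truncated shift bordered by the entry 1 in the lower right corner, linked
   to it by the weight [e]: constant sequences, rescaled by [1/e] in the last
   entry, are fixed. *)
Definition eshift m (e : R) : 'M[C]_m.+2 :=
  wshift (fun a => if a == m :> nat then e else 1)
    (fun a => inord (minn a.+1 m.+1)).

(** Only the last column has two entries, [e] and 1, and [1 + e ^+ 2 <= (1 + e) ^+ 2]. *)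
Lemma ncop_le_eshift m (e : R) n (X : mxtuple R d n) (r : R) :
  0 <= e -> 0 <= r -> ncop_le Q X r ->
  ncop_le Q (fun j => kron (eshift m e) (X j)) ((1 + e) * r).
Proof.
move=> e0 r0 Xr; apply: ncop_le_wshift; rewrite ?addr_ge0// => x x0.
rewrite 2!big_ord_recr/= eqxx gtn_eqF// expr1n mul1r.
rewrite [in leRHS]big_ord_recr/= [in leRHS]big_ord_recl/=.
rewrite -[inord (minn m.+1 m.+1)]/(inord _) minnn.
rewrite (minn_idPr (leqnSn m.+1)) -[inord m.+1]/(inord _).
have -> : inord m.+1 = ord_max :> 'I_m.+2.
  by apply: val_inj; rewrite /= inordK.
set S := (X in X + _ + _ <= _); set S' := (X in _ <= _ * (_ + X + _)).
have -> : S = S'.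
  apply: eq_bigr => a _; rewrite ltn_eqF// expr1n mul1r.
  congr x; apply: val_inj => /=.
  have am : (a.+1 <= m.+1)%N by rewrite ltnS ltnW.
  by rewrite (minn_idPl am) inordK.
have S0 : 0 <= S' by exact: sumr_ge0.
have := x0 ord_max; have := x0 (widen_ord (leqnSn m.+1) ord0).
rewrite !expr2; set y := x _; set z := x _; move=> y0 z0.
have ey : 0 <= (2 * e + e * e) * y by rewrite mulr_ge0// addr_ge0// mulr_ge0.
have eS : 0 <= (2 * e + e * e) * S' by rewrite mulr_ge0// addr_ge0// mulr_ge0.
have ez : 0 <= e * z by rewrite mulr_ge0.
nra.
Qed.

(* The polynomial is [1/(m+1)] times the sum of the blocks of [f (X (x) N)], with
   [N = tshift m]. Evaluating [f] at [X (x) eshift m (1 - r)] shows that each row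
   of blocks sums to [f X] up to an error, and that the column of errors has norm
   at most [M / (1 - r)]; averaging it over the rows gains [sqrt (m + 1)]. *)
Lemma nc_fejer (Q_cont : forall j, continuous (Q j)) (f : gmap Q) (M : R) m :
  nc_function f -> 0 <= M -> (gnorm f <= M%:E)%E ->
  exists p : @ncpoly R d, (gnorm (ncpoly_map p : gmap Q) <= M%:E)%E /\
    forall n (X : ncball Q n) r, 0 <= r -> r < 1 -> ncop_le Q (val X) r ->
      (mxnorm (f n X - polyeval p (val X)) <=
        (M / ((1 - r) * Num.sqrt m.+1%:R))%:E)%E.
Proof.
move=> fnc M0 /gnorm_leP fM.
have [c fc] := nc_wordseries Q_cont m fnc.
pose one_ (p : nat) : 'I_p -> C := fun=> 1.
pose k : C := m.+1%:R^-1; set s := Num.sqrt m.+1%:R.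
have k0 : m.+1%:R != 0 :> C by rewrite pnatr_eq0.
have s0 : 0 < s by rewrite sqrtr_gt0 ltr0n.
have ss : s * s = m.+1%:R by rewrite -expr2 sqr_sqrtr.
have Rek : complex.Re `|k| = m.+1%:R^-1.
  have -> : k = (m.+1%:R^-1)%:C by rewrite /k fmorphV/= rmorph_nat.
  by rewrite ger0_norm// lecR invr_ge0.
have one_s : \sum_(a < m.+1) complex.Re `|one_ m.+1 a| ^+ 2 <= s ^+ 2.
  rewrite (eq_bigr (fun=> 1)) => [|a _]; last by rewrite /one_ normr1 expr1n.
  by rewrite sumr_const card_ord expr2 ss.
(* The entries of [tshift m ^+ size w] sum to [m + 1 - size w], so these are the Fejer weights
   applied to the word series of [f]. *)
pose p : @ncpoly R d :=
  [seq (k * c w * \sum_a \sum_b (tshift m ^+ size w) a b, val w)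
  | w <- enum {: m.-bseq 'I_d}].
have NXB n (X : ncball Q n) :
    ncball Q (\sum_(a < m.+1) n)%N (fun j => kron (tshift m) (val X j)).
  have /ncballP[n0 [r [r0 r1 Xr]]] := ptP X.
  apply/ncballP; split; first by rewrite sum_nat_const card_ord muln_gt0.
  by exists r; split=> //; exact: ncop_le_tshift.
have pE n (X : ncball Q n) : polyeval p (val X) =
    k *: (krow n (one_ m.+1) *m f _ (pt (NXB n X)) *m kcol n (one_ m.+1)).
  have wordE w : wordprod (val (pt (NXB n X))) w =
      kron (tshift m ^+ size w) (wordprod (val X) w).
    elim: w => [|j w IH]; first by rewrite /wordprod !big_nil expr0 kron1.
    by rewrite !wordprod_cons IH kron_mul exprS.
  rewrite fc => [|w wm]; last first.
    rewrite wordE wm; apply/mxblockP => a b; rewrite /kron mxblockK.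
    rewrite tshift_exp ltn_eqF ?scale0r; last first.
      by rewrite addnS ltnS (leq_trans _ (leq_addl _ _))// -ltnS.
    by apply/matrixP => i j; rewrite !mxE.
  rewrite /polyeval big_map big_enum/= mulmx_sumr mulmx_suml scaler_sumr.
  apply: eq_bigr => w _; rewrite wordE -scalemxAr -scalemxAl scalerA -mulmxA.
  rewrite kron_kcol mulmxA krow_kcol mul_scalar_mx scalerA; congr (_ *: _).
  congr (_ * _); apply: eq_bigr => a _; rewrite mul1r.
  by apply: eq_bigr => b _; rewrite mulr1.
exists p; split.
  apply/gnorm_leP => n X; rewrite ncpoly_mapE pE.
  (* The row and the column of ones have norm [s] each, and [s * s] cancels the factor [k]. *)
  have -> : M = complex.Re `|k| * (s * M * s).
    by rewrite Rek mulrAC ss mulrA mulVf ?mul1r// pnatr_eq0.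
  apply/mxnormZ_le/mxnormM_le/mxnorm_kcol => //; last exact: ltW.
  by apply/mxnormM_le/fM/mxnorm_krow => //; exact: ltW.
move=> n X r r0 r1 Xr; set e := 1 - r.
have e0 : 0 < e by rewrite subr_gt0.
(* For [e = 1 - r] the radius [(1 + e) * r] equals [1 - e ^+ 2], hence the point stays in the open
   ball. *)
have YB : ncball Q (\sum_(a < m.+2) n)%N (fun j => kron (eshift m e) (val X j)).
  have /ncballP[n0 _] := ptP X.
  apply/ncballP; split; first by rewrite sum_nat_const card_ord muln_gt0.
  exists ((1 + e) * r); split; first by rewrite mulr_ge0// addr_ge0// ltW.
    by rewrite /e; have := mulr_gt0 e0 e0; rewrite /e; nra.
  by apply: ncop_le_eshift => //; exact: ltW.
(* [V] embeds the first [m + 1] coordinates, [u] is their indicator, and [w] is the vector fixed by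
   [eshift m e]. *)
pose V : 'M[C]_(m.+2, m.+1) := \matrix_(a, b) (a == b :> nat)%:R.
pose w (a : 'I_m.+2) : C := if (a <= m)%N then 1 else (e^-1)%:C.
pose u (a : 'I_m.+2) : C := (a <= m)%:R.
have eC0 : e%:C != 0 by rewrite gt_eqF// ltcR.
have sE (a : 'I_m.+2) :
    (inord (minn a.+1 m.+1) : 'I_m.+2) = minn a.+1 m.+1 :> nat.
  by rewrite inordK// (leq_ltn_trans (geq_minr _ _)).
have fw : f _ (pt YB) *m kcol n w = kcol n w *m f n X.
  apply: nc_intertwine => // j; rewrite kron_kcol; congr (kcol n _ *m _).
  apply/funext => a; rewrite (@wshift_sum R _ C^o).
  rewrite /w sE; case: (ltngtP a m) => am.
  - by rewrite (minn_idPl (leqW am)) am scale1r.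
  - by rewrite (minn_idPr (leqW am)) ltnn scale1r.
  - by rewrite am minnn ltnn -[LHS]rmorphM mulfV// gt_eqF.
(* The image of [V] is invariant under [eshift m e], which restricts to [tshift m] there. *)
have fV : f _ (pt YB) *m kron V 1%:M = kron V 1%:M *m f _ (pt (NXB n X)).
  apply: nc_intertwine => // j; rewrite !kron_mul mul1mx mulmx1.
  congr (kron _ _); apply/matrixP => a b; rewrite wshift_mul.
  rewrite mxE mxE sE; case: (ltngtP a m) => am.
  - rewrite (bigD1 (inord a))//= big1 => [|l la].
      rewrite -[tshift m]expr1 tshift_exp !mxE inordK ?ltnS ?(ltnW am)// eqxx.
      by rewrite addr0 !mul1r addn1 (minn_idPl (leqW am)) eq_sym.
    rewrite mxE; case: eqP => [al|]; last by rewrite mul0r.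
    by case/eqP: la; apply: val_inj; rewrite /= inordK ?ltnS ?(ltnW am).
  - rewrite big1 => [|l _].
      by rewrite (minn_idPr (leqW am)) gtn_eqF ?mulr0.
    rewrite mxE gtn_eqF ?mul0r//.
    by rewrite (leq_trans (ltn_ord l)).
  - rewrite am minnn gtn_eqF// mulr0 big1// => l _.
    rewrite mxE; case: eqP => [al|]; last by rewrite mul0r.
    rewrite -[tshift m]expr1 tshift_exp -al am addn1 ltn_eqF ?mulr0//.
have uw : krow n u *m kcol n w = m.+1%:R%:M.
  rewrite krow_kcol big_ord_recr /= /u ltnn mul0r addr0.
  rewrite (eq_bigr (fun=> 1)) => [|a _]; last first.
    by rewrite /w /= -ltnS ltn_ord mul1r.
  by rewrite sumr_const card_ord.
have uV : krow n u *m kron V 1%:M = krow n (one_ m.+1).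
  rewrite krow_kron mul1mx; congr krow; apply/funext => b.
  rewrite big_ord_recr /= {2}/u ltnn mul0r addr0.
  rewrite (bigD1 b)//= big1 => [|a /negbTE ab].
    by rewrite mxE /u /= -ltnS ltn_ord eqxx mul1r addr0.
  by rewrite mxE /= (inj_eq val_inj) ab mulr0.
have V1 : kron V 1%:M *m kcol n (one_ m.+1) = kcol n u.
  rewrite kron_kcol mulmx1; congr kcol; apply/funext => a.
  rewrite /u; have [am|ma] := leqP a m.
    rewrite (bigD1 (inord a))//= big1 => [|b ab].
      by rewrite mxE inordK ?ltnS// eqxx mulr1 addr0.
    rewrite mxE; case: eqP => [abE|]; last by rewrite mul0r.
    by case/eqP: ab; apply: val_inj; rewrite /= inordK ?ltnS.
  rewrite big1// => b _; rewrite mxE gtn_eqF ?mul0r//.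
  by rewrite (leq_trans (ltn_ord b)).
(* Pairing the row [u] with [w] gives [m + 1] copies of [f n X]; pairing it with [u], the image of
   the ones vector under [V], gives the sum of the blocks of f(X (x) N). The difference [w - u]
   lives in the last coordinate, with value [1 / e]. *)
have fpE : f n X - polyeval p (val X) =
    k *: (krow n u *m f _ (pt YB) *m kcol n (fun a => w a - u a)).
  rewrite -kcolB mulmxBr -!mulmxA fw -V1 [X in _ - _ *m X]mulmxA fV.
  rewrite !mulmxA uw uV scalerBr -pE; congr (_ - _).
  by rewrite mul_scalar_mx scalerA mulVf// scale1r.
rewrite fpE.
have -> : M / (e * s) = complex.Re `|k| * (s * M * e^-1).
  rewrite Rek -ss; field.
  by rewrite !gt_eqF.
apply/mxnormZ_le/mxnormM_le; last first.
  apply: mxnorm_kcol; first by rewrite invr_ge0 ltW.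
  rewrite (eq_bigr (fun a : 'I_m.+2 => if (a <= m)%N then 0 else e^-1 ^+ 2)).
    rewrite big_ord_recr/= ltnn big1 ?add0r// => a _.
    by rewrite -ltnS ltn_ord.
  move=> a _; rewrite /w /u; case: leqP => _.
    by rewrite subrr normr0 expr0n.
  by rewrite subr0 ger0_norm// lecR invr_ge0 ltW.
apply/mxnormM_le/fM/mxnorm_krow; first exact: ltW.
rewrite (eq_bigr (fun a : 'I_m.+2 => (a <= m)%N%:R)) => [|a _]; last first.
  by rewrite /u; case: leqP => _; rewrite ?normr1 ?normr0 ?expr1n ?expr0n.
rewrite big_ord_recr/= ltnn addr0 (eq_bigr (fun=> 1)) => [|a _]; last first.
  by rewrite -ltnS ltn_ord.
by rewrite sumr_const card_ord expr2 ss.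
Qed.

End Fejer.

(** * Coordinates and complete contractivity *)

Section InnerProduct.
Context {R : realType} {V : completeNormedModType R[i]}.
Local Notation C := R[i].
Variable dot : {dot V for Num.conj}.
Hypothesis dotE : forall x : V, dot x x = `|x| ^+ 2.

Lemma dotC x y : dot x y = Num.conj (dot y x).
Proof. by rewrite hermC expr0 mul1r. Qed.

Lemma dotZl a x y : dot (a *: x) y = a * dot x y.
Proof. exact: linearZl_LR. Qed.

Lemma dot_suml (I : Type) (s : seq I) (F : I -> V) y :
  dot (\sum_(i <- s) F i) y = \sum_(i <- s) dot (F i) y.
Proof. exact: linear_sumlz. Qed.

Lemma dotZr a x y : dot x (a *: y) = Num.conj a * dot x y.
Proof. by rewrite [LHS]dotC dotZl rmorphM [in RHS]dotC. Qed.

Lemma dot_sumr (I : Type) (s : seq I) (F : I -> V) y :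
  dot y (\sum_(i <- s) F i) = \sum_(i <- s) dot y (F i).
Proof. exact: linear_sumr. Qed.

Lemma dotD_ortho x y : dot x y = 0 -> `|x + y| ^+ 2 = `|x| ^+ 2 + `|y| ^+ 2.
Proof. by move=> xy; rewrite -!dotE hnormDd. Qed.

Lemma Re_norm_sqr (W : normedModType C) (x : W) :
  (complex.Re `|x| ^+ 2)%:C = `|x| ^+ 2.
Proof. by rewrite rmorphXn/= Re_norm. Qed.

Lemma Re_norm_sqr_sum (W : normedModType C) (I : Type) (s : seq I)
    (F : I -> W) :
  (\sum_(i <- s) complex.Re `|F i| ^+ 2)%:C = \sum_(i <- s) `|F i| ^+ 2.
Proof. by rewrite rmorph_sum; apply: eq_bigr => i _; exact: Re_norm_sqr. Qed.

(* The padding by zeros lets families of different lengths share one index set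
   ['I_N]. *)
Definition orthonormal_upto (p : nat) (e : nat -> V) :=
  forall a b, dot (e a) (e b) = ((a == b) && (a < p)%N)%:R.

Lemma orthonormal_upto0 p e a : orthonormal_upto p e -> (p <= a)%N -> e a = 0.
Proof.
by move=> eo pa; apply/eqP; rewrite -(dnorm_eq0 dot) eo eqxx ltnNge pa.
Qed.

Lemma orthonormal_coord p e N (c : 'I_N -> C) (b : 'I_N) :
  orthonormal_upto p e ->
  dot (\sum_(a < N) c a *: e a) (e b) = c b * (b < p)%N%:R.
Proof.
move=> eo; rewrite dot_suml (bigD1 b)//= big1 => [|a ab].
  by rewrite addr0 dotZl eo eqxx.
by rewrite dotZl eo -[_ == _]/(a == b) (negbTE ab) mulr0.
Qed.

(** Indices below [p] contribute exactly their squared coefficient; the padding contributes 0. *)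
Lemma orthonormal_sum_le p e N (c : 'I_N -> C) : orthonormal_upto p e ->
  complex.Re `|\sum_(a < N) c a *: e a| ^+ 2 <=
  \sum_(a < N) complex.Re `|c a| ^+ 2.
Proof.
move=> eo; rewrite -lecR Re_norm_sqr -dotE dot_sumr Re_norm_sqr_sum.
apply: ler_sum => b _; rewrite dotZr (orthonormal_coord _ _ eo).
rewrite mulrA [X in X * _]mulrC -normCK.
by case: (b < p)%N; rewrite ?mulr1// mulr0 exprn_ge0.
Qed.

(** Pythagoras for [x = (x - y) + y], where [y] is the projection of [x]. *)
Lemma orthonormal_bessel p e N x : orthonormal_upto p e ->
  \sum_(a < N) complex.Re `|dot x (e a)| ^+ 2 <= complex.Re `|x| ^+ 2.
Proof.
move=> eo; pose y := \sum_(a < N) dot x (e a) *: e a.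
have yx a : (a < N)%N -> dot (x - y) (e a) = 0.
  move=> aN; rewrite linearBl/=.
  have /= -> := orthonormal_coord (fun a => dot x (e a)) (Ordinal aN) eo.
  have [ap|pa] := ltnP a p; first by rewrite mulr1 subrr.
  have -> : dot x (e a) = 0 by rewrite (orthonormal_upto0 eo pa) linear0r.
  by rewrite mul0r subrr.
have xyy : dot (x - y) y = 0.
  by rewrite dot_sumr big1// => a _; rewrite dotZr yx// mulr0.
have yy : `|y| ^+ 2 = \sum_(a < N) `|dot x (e a)| ^+ 2.
  rewrite -dotE {2}/y dot_sumr; apply: eq_bigr => a _; rewrite dotZr.
  have := yx a (ltn_ord a); rewrite linearBl/= => /subr0_eq <-.
  by rewrite mulrC -normCK.
rewrite -lecR Re_norm_sqr -[X in `|X|](subrK y) dotD_ortho// yy.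
by rewrite Re_norm_sqr_sum ler_wpDl ?exprn_ge0.
Qed.

Lemma orthonormal_parseval (e : nat -> V) N x : x = \sum_(a < N) dot x (e a) *: e a ->
  complex.Re `|x| ^+ 2 = \sum_(a < N) complex.Re `|dot x (e a)| ^+ 2.
Proof.
move=> xE; apply: complexI; rewrite Re_norm_sqr -dotE {2}xE dot_sumr Re_norm_sqr_sum.
by apply: eq_bigr => a _; rewrite dotZr mulrC -normCK.
Qed.

(** Expansions are stated for every [N] at least [p], so that a family in [H] and one in [K] can
    share the same [N]. *)
Lemma gram_schmidt (s : seq V) : exists p e, orthonormal_upto p e /\
  forall N x, (p <= N)%N -> x \in s -> x = \sum_(a < N) dot x (e a) *: e a.
Proof.
elim: s => [|x s [p [e [eo es]]]].
  exists 0%N, (fun=> 0); split=> [a b|//].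
  by rewrite linear0l andbF.
pose r := x - \sum_(a < p) dot x (e a) *: e a.
have re b : dot r (e b) = 0.
  have [bp|pb] := ltnP b p; last by rewrite (orthonormal_upto0 eo pb) linear0r.
  have /= h := orthonormal_coord (fun a => dot x (e a)) (Ordinal bp) eo.
  by rewrite linearBl/= h bp mulr1 subrr.
have pN N (y : V) : (p <= N)%N ->
    \sum_(a < N) dot y (e a) *: e a = \sum_(a < p) dot y (e a) *: e a.
  move=> pN; rewrite [RHS](big_ord_widen N (fun a => dot y (e a) *: e a))//.
  rewrite [LHS](bigID (fun a : 'I_N => (a < p)%N))/= [X in _ + X]big1 ?addr0//.
  by move=> a; rewrite -leqNgt => /(orthonormal_upto0 eo) ->; rewrite scaler0.
have [r0|r0] := eqVneq r 0.
  exists p, e; split=> // N y pN'; rewrite inE => /predU1P[->|]; last exact: es.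
  by rewrite pN//; apply/eqP; rewrite -subr_eq0; apply/eqP.
have nr : `|r| != 0 by rewrite normr_eq0.
pose z := `|r|^-1 *: r.
have zc : Num.conj `|r|^-1 = `|r|^-1.
  by apply/CrealP; rewrite rpredV normr_real.
have ze b : dot z (e b) = 0 by rewrite dotZl re mulr0.
have ez b : dot (e b) z = 0 by rewrite dotC ze rmorph0.
have zz : dot z z = 1.
  by rewrite dotZl dotZr zc dotE expr2 mulKf// mulVf.
(* The normalised residual is stored at position [p], where the padding had put 0. *)
pose e' a := if a == p then z else e a.
have ep : e p = 0 by exact: orthonormal_upto0 eo (leqnn _).
exists p.+1, e'; split=> [a b|N y pN'].
  rewrite /e'; have [ap|ap] := eqVneq a p; have [bp|bp] := eqVneq b p.
  - by rewrite zz ap bp eqxx ltnSn.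
  - by rewrite ze ap eq_sym (negbTE bp).
  - by rewrite ez bp (negbTE ap).
  - by rewrite eo [(a < p.+1)%N]leq_eqVlt eqSS (negbTE ap).
have e'E (w : V) : \sum_(a < N) dot w (e' a) *: e' a =
    dot w z *: z + \sum_(a < N) dot w (e a) *: e a.
  rewrite (bigD1 (Ordinal pN'))//= [in RHS](bigD1 (Ordinal pN'))//= ep scaler0.
  rewrite add0r /e' eqxx; congr (_ + _); apply: eq_bigr => a.
  by rewrite -(inj_eq val_inj) /= => /negbTE ->.
have pleN : (p <= N)%N by exact: ltnW.
rewrite inE e'E => /predU1P[->|ys]; last first.
  rewrite -es// (_ : dot y z = 0) ?scale0r ?add0r//.
  by rewrite (es _ _ (leqnn p) ys) dot_suml big1// => a _; rewrite dotZl ez mulr0.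
have xz : dot x z = `|r|.
  rewrite -[x](subrK (\sum_(a < p) dot x (e a) *: e a)) -/r linearDl/=.
  rewrite dotZr zc dotE dot_suml big1 => [|a _]; last by rewrite dotZl ez mulr0.
  by rewrite addr0 expr2 mulKf.
by rewrite xz scalerA mulfV// scale1r pN// subrK.
Qed.

(** Gram-Schmidt on the pair reduces this to Cauchy-Schwarz for finite sums. *)
Lemma dot_le x y : complex.Re `|dot x y| <= complex.Re `|x| * complex.Re `|y|.
Proof.
have [p [e [eo es]]] := gram_schmidt [:: x; y].
have xE := es p x (leqnn _) (mem_head _ _).
have yE : y = \sum_(a < p) dot y (e a) *: e a by apply: es; rewrite ?inE ?eqxx ?orbT.
rewrite -(@ler_pXn2r _ 2)// ?nnegrE ?mulr_ge0 ?Re_norm_ge0 ?(@Re_norm_ge0 R C)//.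
rewrite exprMn (orthonormal_parseval xE) (orthonormal_parseval yE).
apply: le_trans (CauchySchwarz_sum _ _ _).
rewrite lerXn2r ?nnegrE ?(@Re_norm_ge0 R C)//.
  by apply: sumr_ge0 => a _; rewrite mulr_ge0 ?(@Re_norm_ge0 R C).
rewrite {1}yE dot_sumr; apply: le_trans (Re_norm_sum _ _) _.
apply: ler_sum => a _.
by rewrite dotZr (@Re_normZ R C) norm_conjC mulrC.
Qed.

End InnerProduct.

(** * Bounds on the coordinates of a point of the ball *)

Section Coordinates.
Context {R : realType} {H K : completeNormedModType R[i]} {d : nat}.
Variable Q : 'I_d -> {linear H -> K}.
Local Notation C := R[i].
Variable dot : {dot K for Num.conj}.
Hypothesis dotE : forall x : K, dot x x = `|x| ^+ 2.

Definition coef_row (u : H * K) : 'rV[C]_d := \row_k dot (Q k u.1) u.2.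

Definition coef_mx (s : seq (H * K)) : 'M[C]_(size s, d) :=
  \matrix_(i < size s) coef_row (nth (0, 0) s i).

(** While the rank is below [d], some nonzero [a] is killed by all rows. By independence y = sum_j
    a_j Q_j x is nonzero for some [x], and the row of the pair (x, y) sends [a] to the squared norm
    of y, so it lies outside the row space. *)
Lemma coef_mx_full : lin_indep Q -> exists s, row_full (coef_mx s).
Proof.
move=> Qi; suff /(_ d (leqnn d)) [s ds] : forall r, (r <= d)%N ->
    exists s, (r <= \rank (coef_mx s))%N.
  by exists s; rewrite /row_full eqn_leq rank_leq_col.
elim=> [_|r IH rd]; first by exists [::].
have [s rs] := IH (ltnW rd).
have [rs'|sr] := ltnP r (\rank (coef_mx s)); first by exists s.
set M := coef_mx s in rs sr.
have kM : cokermx M != 0.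
  rewrite -mxrank_eq0 mxrank_coker subn_eq0 -ltnNge.
  exact: leq_ltn_trans sr rd.
have [k ck] : exists k, col k (cokermx M) != 0.
  apply: contrapT => /forallNP h; case/negP: kM; apply/eqP/matrixP => i k.
  by have /negP/negPn/eqP/colP/(_ i) := h k; rewrite !mxE.
set a := col k (cokermx M) in ck.
have Ma : M *m a = 0 by rewrite /a colE mulmxA mulmx_coker mul0mx.
have [x xQ] : exists x, \sum_j a j 0 *: Q j x != 0.
  apply: contrapT => /forallNP h; case/negP: ck; apply/eqP/colP => j.
  rewrite [RHS]mxE; apply: (Qi (fun j => a j 0)) => x.
  by apply/eqP/negPn/negP; exact: h.
pose u := (x, \sum_j a j 0 *: Q j x); exists (u :: s).
apply: leq_ltn_trans rs (rank_ltmx _); rewrite ltmxE; apply/andP; split.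
  apply/row_subP => i; rewrite (_ : row i M = row (lift ord0 i) (coef_mx (u :: s))).
    exact: row_sub.
  by apply/rowP => l; rewrite !mxE.
apply/negP => /submxP[D uM].
have : row (ord0 : 'I_(size (u :: s))) (coef_mx (u :: s)) *m a = 0.
  by rewrite uM row_mul -mulmxA Ma mulmx0.
move=> /matrixP/(_ 0 0); rewrite !mxE.
rewrite (eq_bigr (fun j => dot (a j 0 *: Q j x) u.2)) => [|j _]; last first.
  by rewrite !mxE dotZl mulrC.
rewrite -dot_suml dotE => /eqP; rewrite sqrf_eq0 normr_eq0.
by rewrite (negbTE xQ).
Qed.

(** Links linear forms in the coordinates to compressions of Q(X). *)
Lemma mxapp_dot n (X : mxtuple R d n) (x : H) (y : K) v i :
  mxapp (\sum_k dot (Q k x) y *: (X k : 'M[C]_n)) v i =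
  dot (ncop Q X (fun k => v k *: x) i) y.
Proof.
rewrite dot_suml /mxapp.
under eq_bigr do rewrite summxE mulr_suml.
rewrite exchange_big; apply: eq_bigr => j _ /=.
rewrite dot_suml; apply: eq_bigr => k _.
rewrite !mxE linearZ scalerA dotZl; ring.
Qed.

Lemma l2norm_dot n (y : 'I_n -> K) z :
  l2norm (fun i => dot (y i) z) <= complex.Re `|z| * l2norm y.
Proof.
rewrite ler_l2norm ?Re_norm_ge0// !l2norm_sqr mulr_sumr ler_sum// => i _.
rewrite -exprMn lerXn2r ?nnegrE ?mulr_ge0 ?Re_norm_ge0 ?(@Re_norm_ge0 R C)//.
by rewrite mulrC dot_le.
Qed.

Lemma l2norm_scale n (v : 'I_n -> C) (x : H) :
  l2norm (fun k => v k *: x) = complex.Re `|x| * l2norm v.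
Proof.
apply/eqP; rewrite -(@eqrXn2 _ 2) ?mulr_ge0 ?l2norm_ge0 ?Re_norm_ge0//.
rewrite exprMn !l2norm_sqr mulr_sumr; apply/eqP/eq_bigr => i _.
by rewrite Re_normZ exprMn mulrC.
Qed.

(** A left inverse [B] of the full-rank matrix writes [X j] as a combination of the compressions
    [T l], each bounded by [r] times the norms of its two vectors. Cauchy-Schwarz over [l] gives a
    constant independent of the level [n]. *)
Lemma coord_bound : lin_indep Q -> exists c : R, 0 <= c /\
  forall n (X : mxtuple R d n) r j, 0 <= r -> ncop_le Q X r ->
    (mxnorm (X j) <= (c * r)%:E)%E.
Proof.
move=> /coef_mx_full[s /row_fullP[B BM]].
pose u (l : 'I_(size s)) := nth (0, 0) s l.
pose b j := \sum_l complex.Re `|B j l| ^+ 2.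
pose t := \sum_l (complex.Re `|(u l).1| * complex.Re `|(u l).2|) ^+ 2.
have t0 : 0 <= t by apply: sumr_ge0 => l _; exact: sqr_ge0.
have b0 j : 0 <= b j by apply: sumr_ge0 => l _; exact: sqr_ge0.
have bt0 : 0 <= (\sum_j b j) * t by rewrite mulr_ge0// sumr_ge0.
exists (Num.sqrt ((\sum_j b j) * t)); split; first exact: sqrtr_ge0.
move=> n X r j r0 Xr; apply/mxnorm_leP; split.
  by rewrite mulr_ge0// sqrtr_ge0.
move=> v; rewrite ler_l2norm ?mulr_ge0 ?sqrtr_ge0// exprMn (sqr_sqrtr bt0).
pose T l := \sum_k dot (Q k (u l).1) (u l).2 *: (X k : 'M[C]_n).
have BQ k : \sum_l B j l * dot (Q k (u l).1) (u l).2 = (j == k)%:R.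
  have /matrixP/(_ j k) := BM; rewrite !mxE => <-.
  by apply: eq_bigr => l _; rewrite !mxE.
have XT : X j = \sum_l B j l *: T l.
  under eq_bigr do rewrite scaler_sumr.
  rewrite exchange_big /= (eq_bigr (fun k => (j == k)%:R *: X k)) => [|k _].
    rewrite (bigD1 j)//= eqxx scale1r big1 ?addr0// => k.
    by rewrite eq_sym => /negbTE ->; rewrite scale0r.
  by under eq_bigr do rewrite scalerA; rewrite -scaler_suml BQ.
have Tv l : l2norm (mxapp (T l) v) <=
    complex.Re `|(u l).2| * (r * (complex.Re `|(u l).1| * l2norm v)).
  rewrite (_ : mxapp (T l) v = fun i =>
    dot (ncop Q X (fun k => v k *: (u l).1) i) (u l).2); last first.
    by apply/funext => i; exact: mxapp_dot.
  apply: le_trans (l2norm_dot _ _) _; rewrite ler_wpM2l ?Re_norm_ge0//.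
  by apply: le_trans (Xr _) _; rewrite l2norm_scale.
have Xv i : complex.Re `|mxapp (X j) v i| ^+ 2 <=
    b j * \sum_l complex.Re `|mxapp (T l) v i| ^+ 2.
  have -> : mxapp (X j) v i = \sum_l B j l * mxapp (T l) v i.
    rewrite XT /mxapp; under [RHS]eq_bigr do rewrite mulr_sumr.
    rewrite exchange_big; apply: eq_bigr => k _ /=.
    by rewrite summxE mulr_suml; apply: eq_bigr => l _; rewrite mxE mulrA.
  apply: le_trans (CauchySchwarz_sum _ _ _).
  rewrite lerXn2r ?nnegrE ?(@Re_norm_ge0 R C)//.
    by apply: sumr_ge0 => l _; rewrite mulr_ge0 ?(@Re_norm_ge0 R C).
  apply: le_trans (Re_norm_sum _ _) _; apply: ler_sum => l _.
  by rewrite (@Re_normZ R C).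
rewrite l2norm_sqr; apply: le_trans (ler_sum _ (fun i _ => Xv i)) _.
rewrite -mulr_sumr -!mulrA ler_pM// ?sumr_ge0//.
  by move=> i _; apply: sumr_ge0 => l _; exact: sqr_ge0.
  by rewrite (bigD1 j)//= lerDl sumr_ge0.
rewrite exchange_big mulr_suml; apply: ler_sum => l _.
apply: (@le_trans _ _ (l2norm (mxapp (T l) v) ^+ 2)); first by rewrite l2norm_sqr.
have := Tv l; rewrite -(@ler_pXn2r _ 2)// ?nnegrE ?mulr_ge0 ?l2norm_ge0 ?Re_norm_ge0//.
move=> /le_trans; apply; rewrite !exprMn le_eqVlt; apply/orP; left; apply/eqP.
ring.
Qed.

End Coordinates.

(** * Representations land in the closed ball *)

Section CompleteContractivity.
Context {R : realType} {H K : completeNormedModType R[i]} {d : nat}.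
Context {Q : 'I_d -> {linear H -> K}}.
Local Notation C := R[i].
Variable dotH : {dot H for Num.conj}.
Hypothesis dotHE : forall x : H, dotH x x = `|x| ^+ 2.
Variable dotK : {dot K for Num.conj}.
Hypothesis dotKE : forall x : K, dotK x x = `|x| ^+ 2.

Lemma ncop_sum n (X : mxtuple R d n) N (w : 'I_N -> 'I_n -> H) i :
  ncop Q X (fun k => \sum_b w b k) i = \sum_b ncop Q X (w b) i.
Proof.
rewrite /ncop [RHS]exchange_big; apply: eq_bigr => j _ /=.
rewrite [RHS]exchange_big; apply: eq_bigr => k _ /=.
by rewrite linear_sum scaler_sumr.
Qed.

(** Q(X) compressed to the spans of [e] and [f]. Its blocks are linear in the coordinates, so a
    linear map on the algebra acts on it block by block. *)
Definition compression n (X : mxtuple R d n) N (e : nat -> H) (f : nat -> K) :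
    'M[C]_(\sum_(a < N) n)%N :=
  \mxblock_(a < N, b < N) \sum_j dotK (Q j (e b)) (f a) *: (X j : 'M[C]_n).

Lemma mxapp_compression n (X : mxtuple R d n) N e f u a i :
  mxapp (compression X N e f) u (tagnat.Rank a i) =
  dotK (ncop Q X (fun k => \sum_(b < N) u (tagnat.Rank b k) *: e b) i) (f a).
Proof.
rewrite mxapp_mxblock ncop_sum dot_suml; apply: eq_bigr => b _.
exact: mxapp_dot.
Qed.

Lemma l2norm_compression n (X : mxtuple R d n) N e f u :
  l2norm (mxapp (compression X N e f) u) ^+ 2 =
  \sum_i \sum_(a < N) complex.Re `|dotK (ncop Q X
    (fun k => \sum_(b < N) u (tagnat.Rank b k) *: e b) i) (f a)| ^+ 2.
Proof.
rewrite l2norm_sqr sum_Rank exchange_big; apply: eq_bigr => i _.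
by apply: eq_bigr => a _; rewrite mxapp_compression.
Qed.

(** Three contractions in a row: synthesis along [e], then Q(X), then taking coefficients along [f]
    (Bessel). *)
Lemma mxnorm_compression n (X : mxtuple R d n) N p q e f :
  orthonormal_upto dotH p e -> orthonormal_upto dotK q f ->
  ncop_le Q X 1 -> (mxnorm (compression X N e f) <= 1)%E.
Proof.
move=> eo fo X1; apply/mxnorm_leP; split=> // u.
rewrite ler_l2norm// l2norm_compression expr1n mul1r.
set w := fun k : 'I_n => \sum_(b < N) u (tagnat.Rank b k) *: e b.
apply: (@le_trans _ _ (l2norm (ncop Q X w) ^+ 2)).
  rewrite l2norm_sqr ler_sum// => i _; exact: (orthonormal_bessel dotKE).
apply: (@le_trans _ _ (l2norm w ^+ 2)).
  by have := X1 w; rewrite ler_l2norm// expr1n mul1r.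
rewrite l2norm_sqr l2norm_Rank.
under [leRHS]eq_bigr do rewrite l2norm_sqr.
rewrite [leRHS]exchange_big; apply: ler_sum => k _.
exact: (orthonormal_sum_le dotHE).
Qed.

(** For a given [v], choose [e] to span the entries of [v] and [f] those of Q(X)v: then the
    compression loses nothing on [v]. *)
Lemma ncop_le1_compression n (X : mxtuple R d n) :
  (forall N p q e f, orthonormal_upto dotH p e -> orthonormal_upto dotK q f ->
    (mxnorm (compression X N e f) <= 1)%E) ->
  ncop_le Q X 1.
Proof.
move=> X1 v.
have [p [e [eo ev]]] := gram_schmidt dotHE (codom v).
have [q [f [fo fv]]] := gram_schmidt dotKE (codom (ncop Q X v)).
set N := maxn p q; pose c (b : 'I_N) : 'cV[C]_n := \col_k dotH (v k) (e b).
pose u s := (\mxcol_(b < N) c b) s 0.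
have uE b (k : 'I_n) : u (tagnat.Rank b k) = dotH (v k) (e b).
  transitivity (submxcol (\mxcol_(b < N) c b) b k 0); first by rewrite [RHS]mxE.
  by rewrite mxcolK mxE.
have vE : (fun k : 'I_n => \sum_(b < N) u (tagnat.Rank b k) *: e b) = v.
  apply/funext => k; rewrite [RHS](ev N) ?leq_maxl ?codom_f//.
  by apply: eq_bigr => b _; rewrite uE.
have /mxnorm_leP[_ /(_ u)] := X1 N p q e f eo fo.
rewrite !ler_l2norm// !expr1n !mul1r l2norm_compression.
rewrite vE (eq_bigr (fun i => complex.Re `|ncop Q X v i| ^+ 2)) => [|i _]; last first.
  by rewrite (orthonormal_parseval dotKE (fv N _ _ _)) ?leq_maxr ?codom_f.
rewrite -l2norm_sqr => /le_trans; apply.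
rewrite l2norm_Rank; under eq_bigr do rewrite l2norm_sqr.
rewrite exchange_big l2norm_sqr; apply: ler_sum => k _.
under eq_bigr do rewrite uE.
exact: (orthonormal_bessel dotHE).
Qed.

Section Rep.
Variable A : subalgClosed (gmap Q).

Lemma linear_fun_sum (U W : lmodType C) (Phi : U -> W) (I : Type) (s : seq I)
    (c : I -> C) (F : I -> U) : linear Phi ->
  Phi (\sum_(i <- s) c i *: F i) = \sum_(i <- s) c i *: Phi (F i).
Proof.
move=> Phil; elim/big_rec2: _ => [|i x y _ <-]; last exact: Phil.
by have := Phil (-1) 0 0; rewrite scaler0 addr0 scaleN1r addNr.
Qed.

(** The matrix [F] of linear forms evaluates on the ball to compressions of norm at most 1, and
    [Phi] sends it to the compression at Phi(Z). *)
Lemma repcc_cncball (Z : 'I_d -> fun_alg A) n (Phi : {ptws fun_alg A -> 'M[C]_n}) :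
  (forall j, val (Z j) = gcoord Q j) -> (0 < n)%N -> repcc A n Phi ->
  cncball Q n (evalat Z n Phi).
Proof.
move=> ZE n0 [Phil Phim Phic]; apply/cncballP; split=> //.
apply: ncop_le1_compression => N p q e f eo fo.
pose F (a b : 'I_N) : fun_alg A := \sum_j dotK (Q j (e b)) (f a) *: Z j.
have -> : compression (evalat Z n Phi) N e f = \mxblock_(a, b) Phi (F a b).
  by apply: eq_mxblock => a b; rewrite /F (linear_fun_sum _ _ _ Phil).
apply: le_trans (Phic N F) _; apply: ge_ereal_sup => _ [m [Y ->]].
have -> : \mxblock_(a, b) val (F a b) m Y = compression (val Y) N e f.
  apply: eq_mxblock => a b; rewrite /F raddf_sum gmap_sum; apply: eq_bigr => j _.
  transitivity ((dotK (Q j (e b)) (f a) *: val (Z j)) m Y); last by rewrite ZE.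
  by congr (_ m Y); exact: linearZ.
apply: mxnorm_compression eo fo _.
have /ncballP[_ [r [_ r1 Yr]]] := ptP Y.
by apply: ncop_le_trans Yr; exact: ltW.
Qed.

End Rep.

End CompleteContractivity.

(** * Representations *)

Section Convergence.
Context {R : realType}.
Local Notation C := R[i].

Lemma cvg_mx (T : Type) (F : set_system T) m n (h : T -> 'M[C]_(m, n))
    (A : 'M[C]_(m, n)) :
  Filter F -> (forall i j, h x i j @[x --> F] --> A i j) ->
  h x @[x --> F] --> A.
Proof.
move=> FF hA P [B AB BP].
have FB : \forall x \near F, forall ij : 'I_m * 'I_n, B ij.1 ij.2 (h x ij.1 ij.2).
  by apply: filter_forall => -[i j]; exact: hA (AB i j).
by apply: filterS FB => x Bx; apply: BP => i j; exact: (Bx (i, j)).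
Qed.

Lemma cvg_ptws (T I : Type) (V : topologicalType) (F : set_system T)
    (h : T -> {ptws I -> V}) (f : {ptws I -> V}) : Filter F ->
  (forall i, h x i @[x --> F] --> f i) -> h x @[x --> F] --> f.
Proof.
move=> FF hf; apply/cvg_sup => i W.
have /= -> := @nbhsE (initial_topology (@proj I (fun=> V) i)) f.
case=> B [[D oD <-] Dfi] BW; apply: (filterS BW).
by apply: (hf i D); exact: open_nbhs_nbhs.
Qed.

Lemma cvgCP (T : Type) (F : set_system T) (h : T -> C) (l : C) : Filter F ->
  h x @[x --> F] --> l <->
  forall e : R, 0 < e -> \forall x \near F, `|l - h x| <= e%:C.
Proof.
move=> FF; split=> [/(@cvgrPdist_le C C^o) hl e e0|hl].
  by apply: hl; rewrite ltcR.
apply/(@cvgrPdist_le C C^o) => e e0.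
have eE : e = (complex.Re e)%:C by rewrite RRe_real// gtr0_real.
by rewrite eE; apply: hl; rewrite -ltcR -eE.
Qed.

(** The three-epsilon argument; the approximant [h] may depend on [e]. It is applied with
    polynomials for [h]. *)
Lemma cvg_uniform_approx (T : Type) (F : set_system T) (g : T -> C) (l : C) :
  Filter F ->
  (forall e : R, 0 < e -> exists (h : T -> C) (k : C),
    [/\ h x @[x --> F] --> k, `|l - k| <= e%:C &
      \forall x \near F, `|g x - h x| <= e%:C]) ->
  g x @[x --> F] --> l.
Proof.
move=> FF gh; apply/cvgCP => e e0.
have [|h [k [/cvgCP hk lk ghx]]] := gh (e / 3); first by rewrite divr_gt0.
have {}hk := hk (e / 3) (divr_gt0 e0 (ltr0n _ 3)).
apply: filterS2 hk ghx => x kx gx.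
have -> : l - g x = (l - k) + (k - h x) - (g x - h x) by ring.
apply: le_trans (ler_normB _ _) _.
have -> : e%:C = (e / 3)%:C + (e / 3)%:C + (e / 3)%:C.
  by rewrite -!rmorphD; congr (_%:C); field.
by rewrite lerD// (le_trans (ler_normD _ _))// lerD.
Qed.

Lemma ultra_fmap (T S : Type) (U : set_system T) (h : T -> S) :
  UltraFilter U -> UltraFilter (h @ U).
Proof.
move=> UU; split; first exact: fmap_proper_filter.
move=> G GG UG; apply/seteqP; split=> // B GB.
have [//|UB] := in_ultra_setVsetC (h @^-1` B) UU.
have GB' : G (~` B) by exact: UG.
have /filter_ex[x [] //] : G (B `&` ~` B) by exact: filterI.
Qed.

(** The image ultrafilter contains a segment, which is compact. *)
Lemma ultra_bounded_cvgR (T : Type) (U : set_system T) (h : T -> R) (M : R) :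
  UltraFilter U -> (forall x, `|h x| <= M) ->
  exists l : R, h x @[x --> U] --> l.
Proof.
move=> UU hM; have hU := ultra_fmap h UU.
have := @segment_compact R (- M) M; rewrite compact_ultra => /(_ (h @ U) hU).
case=> [|l [_ hl]]; last by exists l.
apply: (@filterS _ U _ setT); last exact: filterT.
by move=> x _ /=; rewrite in_itv/= -ler_norml.
Qed.

Lemma ultra_bounded_cvg (T : Type) (U : set_system T) (h : T -> C) (M : R) :
  UltraFilter U -> (forall x, `|h x| <= M%:C) ->
  exists l : C, h x @[x --> U] --> l.
Proof.
move=> UU hM.
have [x|a ha] := ultra_bounded_cvgR (h := fun x => complex.Re (h x)) UU (M := M).
  by rewrite -lecR (le_trans _ (hM x))// normc_ge_Re.
have [x|b hb] := ultra_bounded_cvgR (h := fun x => complex.Im (h x)) UU (M := M).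
  rewrite -lecR (le_trans _ (hM x))//; case: (h x) => u v.
  by rewrite normc_def lecR -sqrtr_sqr ler_wsqrtr// lerDr sqr_ge0.
exists (a +i* b)%C; apply/cvgCP => e e0.
have e2 : 0 < e / 2 by rewrite divr_gt0.
move/cvgrPdist_le : ha => /(_ _ e2) ha; move/cvgrPdist_le : hb => /(_ _ e2) hb.
apply: filterS2 ha hb => x ax bx.
have -> : (a +i* b)%C - h x =
    (a - complex.Re (h x))%:C + 'i%C * (b - complex.Im (h x))%:C.
  by case: (h x) => u v; simpc.
apply: le_trans (ler_normD _ _) _.
rewrite normrM (_ : `|'i%C| = 1 :> C) ?mul1r; last first.
  by rewrite normc_def /= expr0n expr1n add0r sqrtr1.
have -> : e%:C = (e / 2)%:C + (e / 2)%:C by rewrite -rmorphD/= -splitr.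
by apply: lerD; rewrite normc_def/= expr0n addr0 sqrtr_sqr lecR.
Qed.

End Convergence.

(** * Representations over points of the closed ball *)

Section Representations.
Context {R : realType} {H K : completeNormedModType R[i]} {d : nat}.
Context {Q : 'I_d -> {linear H -> K}}.
Local Notation C := R[i].

Lemma entry_continuous n (j : 'I_d) (a b : 'I_n) :
  continuous (fun X : mxtuple R d n => X j a b).
Proof.
move=> X; apply: (@continuous_comp _ _ _ (fun X : mxtuple R d n => X j)
  (fun A : 'M[C]_n => A a b)); last exact: coord_continuous.
exact: (@proj_continuous 'I_d (fun=> 'M[C]_n) j).
Qed.

Lemma wordprod_continuous n (w : seq 'I_d) (a b : 'I_n) :
  continuous (fun X : mxtuple R d n => wordprod X w a b).
Proof.
elim: w a b => [|j w IH] a b.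
  rewrite (_ : (fun _ => _) = fun=> (1%:M : 'M[C]_n) a b).
    exact: cst_continuous.
  by apply/funext => X; rewrite /wordprod big_nil.
rewrite (_ : (fun _ => _) = fun X : mxtuple R d n =>
  \sum_k X j a k * wordprod X w k b).
  apply: (@continuous_big _ _ +%R); first exact: add_continuous.
  move=> k _ X; apply: continuousM; [exact: entry_continuous|exact: IH].
by apply/funext => X; rewrite wordprod_cons mxE.
Qed.

Lemma polyeval_continuous n (p : @ncpoly R d) (a b : 'I_n) :
  continuous (fun X : mxtuple R d n => polyeval p X a b).
Proof.
rewrite (_ : (fun _ => _) = fun X : mxtuple R d n =>
  \sum_(t <- p) t.1 * wordprod X t.2 a b).
  apply: (@continuous_big _ _ +%R); first exact: add_continuous.
  move=> t _ X; apply: continuousM; first exact: cst_continuous.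
  exact: wordprod_continuous.
by apply/funext => X; rewrite summxE; apply: eq_bigr => t _; rewrite mxE.
Qed.

(** The dimension of a one-block matrix is a sum over ['I_1], not literally [n]. The lemma extracts
    plain contractivity from the case [k = 1] of complete contractivity. *)
Lemma mxnorm_block1 n (A : 'M[C]_n) (M : R) :
  (mxnorm (\mxblock_(a < 1, b < 1) A) <= M%:E <-> mxnorm A <= M%:E)%E.
Proof.
have l2E v : l2norm v = l2norm (fun k : 'I_n =>
    v (tagnat.Rank (ord0 : 'I_1) k) : C).
  by apply/eqP; rewrite -(@eqrXn2 _ 2) ?l2norm_ge0// l2norm_Rank big_ord1.
have mxE v : (fun k => mxapp (\mxblock_(a < 1, b < 1) A) v
      (tagnat.Rank (ord0 : 'I_1) k)) =
    mxapp A (fun k : 'I_n => v (tagnat.Rank (ord0 : 'I_1) k)).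
  by apply/funext => k; rewrite mxapp_mxblock big_ord1.
split=> /mxnorm_leP[M0 AM]; apply/mxnorm_leP; split=> // v; last first.
  by rewrite l2E mxE [l2norm v]l2E.
pose u s := (\mxcol_(b < 1) \col_(k < n) v k) s 0.
have uE : (fun k : 'I_n => u (tagnat.Rank (ord0 : 'I_1) k)) = v.
  apply/funext => k.
  transitivity (submxcol (\mxcol_(b < 1) \col_(k < n) v k) ord0 k 0).
    by rewrite [RHS]matrix.mxE.
  by rewrite mxcolK matrix.mxE.
by have := AM u; rewrite l2E mxE uE [l2norm u]l2E uE.
Qed.

Variable A : subalgClosed (gmap Q).

Lemma repcc_norm n (Phi : {ptws fun_alg A -> 'M[C]_n}) (g : fun_alg A) (M : R) :
  repcc A n Phi -> (gnorm (val g) <= M%:E)%E ->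
  (mxnorm (Phi g : 'M[C]_n) <= M%:E)%E.
Proof.
move=> [_ _ Phic] gM; apply/mxnorm_block1; apply: le_trans (Phic 1%N (fun _ _ => g)) _.
apply: ge_ereal_sup => _ [m [Y ->]]; apply/mxnorm_block1.
by move/gnorm_leP : gM => /(_ m Y).
Qed.

Variable Z : 'I_d -> fun_alg A.
Hypothesis ZE : forall j, val (Z j) = gcoord Q j.

Definition polyalg (p : @ncpoly R d) : fun_alg A :=
  \sum_(t <- p) t.1 *: \prod_(j <- t.2) Z j.

Lemma val_polyalg p : val (polyalg p) = ncpoly_map p.
Proof.
rewrite /polyalg raddf_sum; apply: eq_bigr => t _.
transitivity (t.1 *: val (\prod_(j <- t.2) Z j)); first exact: linearZ.
congr (_ *: _); rewrite rmorph_prod.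
by apply: eq_bigr => j _; exact: ZE.
Qed.

Lemma repcc_polyalg n (Phi : {ptws fun_alg A -> 'M[C]_n}) p :
  repcc A n Phi -> Phi (polyalg p) = polyeval p (evalat Z n Phi).
Proof.
move=> [Phil [Phi1 PhiM] _]; rewrite /polyalg (linear_fun_sum _ _ _ Phil).
apply: eq_bigr => t _; congr (_ *: _).
exact: (big_morph (Phi : fun_alg A -> 'M[C]_n) PhiM Phi1).
Qed.

(** Contractivity carries a norm approximation on the open ball over to Phi(Z), which may lie on the
    boundary. *)
Lemma repcc_approx n (Phi : {ptws fun_alg A -> 'M[C]_n}) (g : fun_alg A) p
    (e : R) a b : repcc A n Phi ->
  (gnorm (val g - ncpoly_map p) <= e%:E)%E ->
  `|Phi g a b - polyeval p (evalat Z n Phi) a b| <= e%:C.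
Proof.
move=> PhiA gp; rewrite -(repcc_polyalg p PhiA).
have [Phil _ _] := PhiA.
have -> : Phi g a b - Phi (polyalg p) a b = Phi (g - polyalg p) a b.
  have := Phil (-1) (polyalg p) g; rewrite !scaleN1r [_ + g]addrC => ->.
  by rewrite [RHS]mxE [in RHS]mxE addrC.
have gp' : (gnorm (val (g - polyalg p)%R) <= e%:E)%E.
  by rewrite raddfB/= val_polyalg.
exact: mxnorm_entry (repcc_norm PhiA gp').
Qed.

Lemma evalat_continuous n : continuous (evalat Z n : _ -> mxtuple R d n).
Proof.
move=> Phi; apply: (@cvg_ptws _ _ _ (nbhs Phi) (evalat Z n) _ (nbhs_filter Phi)) => j.
exact: (@proj_continuous (fun_alg A) (fun=> 'M[C]_n) (Z j)).
Qed.

Hypothesis AH : forall f : gmap Q, f \in A -> f \in Hinf Q.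

Lemma fun_alg_bounded (g : fun_alg A) : exists2 M : R,
  0 <= M & (gnorm (val g) <= M%:E)%E.
Proof.
have /AH/in_Hinf[_ gb] := valP g.
exists (fine (gnorm (val g))); last exact: gnorm_fin.
by rewrite fine_ge0// gnorm_ge0.
Qed.

Lemma ncball_shrink n (X : mxtuple R d n) (k : nat) : cncball Q n X ->
  ncball Q n (fun j => (1 - k.+1%:R^-1 : R)%:C *: X j).
Proof.
move=> /cncballP[n0 X1]; apply/ncballP; split=> //.
have k0 : 0 < k.+1%:R^-1 :> R by rewrite invr_gt0.
have k1 : 0 <= 1 - k.+1%:R^-1 :> R by rewrite subr_ge0 invf_le1// ler1n.
exists (1 - k.+1%:R^-1); split=> //.
have := ncop_leZ (1 - k.+1%:R^-1)%:C X1.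
by rewrite ger0_norm ?lecR// mulr1.
Qed.

(* The representation is an ultrafilter limit of the evaluations at the points
   [(1 - 1/(k+1)) X] of the open ball. *)
Lemma repcc_exists n (X : mxtuple R d n) : cncball Q n X ->
  exists2 Phi, repcc A n Phi & evalat Z n Phi = X.
Proof.
move=> XB; have [U [UU ooU]] := ultraFilterLemma (@eventually_filter).
pose Y k := pt (ncball_shrink k XB).
have lim_ (g : fun_alg A) i j : exists l : C, val g n (Y k) i j @[k --> U] --> l.
  have [M _ /gnorm_leP gM] := fun_alg_bounded g.
  by apply: (ultra_bounded_cvg (M := M)) => k; exact: mxnorm_entry.
pose Phi : {ptws fun_alg A -> 'M[C]_n} := fun g => \matrix_(i, j) projT1 (cid (lim_ g i j)).
have PhiP (g : fun_alg A) i j : val g n (Y k) i j @[k --> U] --> Phi g i j.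
  by rewrite mxE; case: cid.
have uniq (h : nat -> C) (l l' : C) : h k @[k --> U] --> l -> h k @[k --> U] --> l' -> l = l'.
  exact: (@cvg_unique C (@norm_hausdorff C C) (h @ U) _).
exists Phi.
  split.
  - move=> a u v; apply/matrixP => i j.
    transitivity (a * Phi u i j + Phi v i j); last by rewrite [RHS]mxE [in RHS]mxE.
    apply: uniq (PhiP _ i j) _.
    rewrite (_ : (fun k => _) = fun k : nat =>
      a * val u n (Y k) i j + val v n (Y k) i j); last first.
      apply/funext => k; rewrite linearP.
      by rewrite [LHS](_ : _ = (a *: val u n (Y k) + val v n (Y k)) i j)// !mxE.
    apply: cvgD; last exact: PhiP.
    by apply: cvgM; [exact: cvg_cst|exact: PhiP].
  - split.
      apply/matrixP => i j; apply: uniq (PhiP _ i j) _.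
      exact: cvg_cst.
    move=> u v; apply/matrixP => i j.
    transitivity (\sum_l Phi u i l * Phi v l j); last by rewrite [RHS]mxE.
    apply: uniq (PhiP _ i j) _.
    rewrite (_ : (fun k => _) = fun k : nat =>
      \sum_l val u n (Y k) i l * val v n (Y k) l j); last first.
      apply/funext => k; rewrite rmorphM.
      by rewrite [LHS](_ : _ = (val u n (Y k) *m val v n (Y k)) i j)// mxE.
    apply: (@cvg_big _ _ +%R); first exact: add_continuous.
    by move=> l _; apply: cvgM; exact: PhiP.
  - move=> k F.
    pose B l := \mxblock_(i < k, j < k) (val (F i j) n (Y l) : 'M[C]_n).
    have BU : B l @[l --> U] --> \mxblock_(i < k, j < k) (Phi (F i j) : 'M[C]_n).
      apply: cvg_mx => s t; rewrite mxE; under eq_fun do rewrite mxE.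
      exact: PhiP.
    (* For a fixed vector the norm is continuous in the matrix, so the bound valid for every [B l]
       survives the limit. *)
    apply/opnorm_leP => v v1.
    set M := gmatnorm _.
    have BM l : ((l2norm (mxapp (B l) v))%:E <= M)%E.
      suff /opnorm_leP/(_ v v1) : (mxnorm (B l) <= M)%E by [].
      by apply: ereal_sup_ubound; exists n, (Y l).
    case: M BM => [m||] BM; [|by rewrite leey|by have := BM 0%N].
    rewrite lee_fin.
    have := cvg_comp _ _ BU (@l2norm_mxapp_continuous R _ _ v _).
    apply: (closed_cvg (fun r => r <= m)); first exact: closed_le.
    by apply: nearW => l; have := BM l; rewrite lee_fin.
apply/funext => j; apply/matrixP => a b; apply: uniq (PhiP _ a b) _.
rewrite ZE; apply/cvgCP => e e0.
set x := X j a b; pose y := complex.Re `|x|.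
have y0 : 0 < 1 + y by rewrite ltr_pwDl// (@Re_norm_ge0 R C).
have ey : 0 < e / (1 + y) by rewrite divr_gt0.
apply: ooU; have := near_infty_natSinv_lt (PosNum ey).
apply: filterS => k /= ke; rewrite [X in _ - X]mxE -/x.
have -> : x - (1 - k.+1%:R^-1)%:C * x = (k.+1%:R^-1)%:C * x.
  by rewrite rmorphB rmorph1 mulrBl mul1r opprB addrC subrK.
rewrite normrM -[`|x|]Re_norm -/y ger0_norm ?lecR ?invr_ge0// -rmorphM lecR.
apply: le_trans (ler_wpM2r _ (ltW ke)) _; first exact: (@Re_norm_ge0 R C).
by rewrite mulrAC ler_pdivrMr// ler_pM2l// lerDr.
Qed.

End Representations.

(** * Openness of the ball, and membership of the coordinate functions *)

Section BallTopology.
Context {R : realType} {H K : completeNormedModType R[i]} {d : nat}.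
Variable Q : 'I_d -> {linear H -> K}.
Local Notation C := R[i].

(** Minkowski's inequality; the constant 1 is what keeps the radius of nearby points below 1 in
    [ncop_le_near]. *)
Lemma l2normD (V : normedModType C) n (v w : 'I_n -> V) :
  l2norm (fun i => v i + w i) <= l2norm v + l2norm w.
Proof.
rewrite -(@ler_pXn2r _ 2)// ?nnegrE ?addr_ge0 ?l2norm_ge0//.
have vw : \sum_i complex.Re `|v i| * complex.Re `|w i| <= l2norm v * l2norm w.
  rewrite -(@ler_pXn2r _ 2)// ?nnegrE ?mulr_ge0 ?l2norm_ge0//; last first.
    by apply: sumr_ge0 => i _; rewrite mulr_ge0 ?Re_norm_ge0.
  by rewrite exprMn !l2norm_sqr CauchySchwarz_sum.
rewrite sqrrD !l2norm_sqr.
apply: (@le_trans _ _ (\sum_i (complex.Re `|v i| ^+ 2 +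
    complex.Re `|v i| * complex.Re `|w i| *+ 2 + complex.Re `|w i| ^+ 2))).
  apply: ler_sum => i _; rewrite -sqrrD lerXn2r ?nnegrE ?addr_ge0 ?Re_norm_ge0//.
  exact: Re_normD.
by rewrite 2!big_split/= lerD2r lerD2l sumrMnl lerMn2r.
Qed.

Lemma ncop_leD n (X Y : mxtuple R d n) (r s : R) :
  ncop_le Q Y r -> ncop_le Q (fun j => X j - Y j) s -> ncop_le Q X (r + s).
Proof.
move=> Yr XYs v; rewrite (ncopB Q X Y); apply: le_trans (l2normD _ _) _.
by rewrite mulrDl lerD.
Qed.

Hypothesis Q_cont : forall j, continuous (Q j).

(** By [ncop_le_entry], the radius grows by at most a multiple of the entries of Y - X, which tend
    to 0. *)
Lemma ncop_le_near n (X : mxtuple R d n) (r s : R) : r < s ->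
  ncop_le Q X r -> \forall Y \near X, ncop_le Q Y s.
Proof.
move=> rs Xr; have [B B0 QB] := ncop_le_entry Q_cont.
have ent_cont : continuous (fun Y : mxtuple R d n =>
    entry_sum (fun j => Y j - X j : 'M[C]_n)).
  apply: (@continuous_big _ _ +%R) => [|a _]; first exact: add_continuous.
  apply: (@continuous_big _ _ +%R) => [|j _]; first exact: add_continuous.
  apply: (@continuous_big _ _ +%R) => [|b _ Y]; first exact: add_continuous.
  apply: (@continuous_comp _ _ _ (fun Y : mxtuple R d n =>
    `|(Y j - X j : 'M[C]_n) a b|) (@complex.Re R)); last exact: Re_continuous.
  apply: (@continuous_comp _ _ _ (fun Y : mxtuple R d n =>
    (Y j - X j : 'M[C]_n) a b) Num.norm); last exact: norm_continuous.
  rewrite (_ : (fun Y : mxtuple R d n => _) =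
    fun Y : mxtuple R d n => Y j a b - X j a b); last first.
    by apply/funext => W; rewrite !mxE.
  by apply: continuousB; [exact: entry_continuous|exact: cst_continuous].
have B1 : 0 < B + 1 by rewrite ltr_wpDl.
have e0 : 0 < (s - r) / (B + 1) by rewrite divr_gt0// subr_gt0.
have XX : entry_sum (fun j => X j - X j : 'M[C]_n) = 0.
  rewrite /entry_sum big1// => j _; rewrite big1// => a _; rewrite big1// => b _.
  by rewrite subrr mxE normr0.
have := ent_cont X; rewrite /continuous_at XX => /cvgr_lt/(_ _ e0).
apply: filterS => Y Ye; have -> : s = r + (s - r) by rewrite addrC subrK.
apply: ncop_leD Xr _; apply: ncop_le_trans (QB _ _).
have := ltW Ye; rewrite ler_pdivlMr// => /(le_trans _); apply.
by rewrite mulrDr mulr1 mulrC lerDl entry_sum_ge0.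
Qed.

Lemma sqrt_near (T : R) : \forall m \near \oo, T <= Num.sqrt m.+1%:R.
Proof.
exists (Num.truncn (T ^+ 2)) => // m /= Tm.
apply: le_trans (ler_norm T) _; rewrite -sqrtr_sqr ler_wsqrtr//.
by apply: le_trans (ltW (truncnS_gt _)) _; rewrite ler_nat ltnS.
Qed.

Lemma fejer_near (M r e : R) : r < 1 -> 0 < e ->
  \forall m \near \oo, M / ((1 - r) * Num.sqrt m.+1%:R) <= e.
Proof.
move=> r1 e0; have r0 : 0 < 1 - r by rewrite subr_gt0.
have := sqrt_near (M / ((1 - r) * e)); apply: filterS => m.
have s0 : 0 < Num.sqrt m.+1%:R :> R by rewrite sqrtr_gt0.
by rewrite !ler_pdivrMr ?mulr_gt0// mulrCA mulrA [e * _]mulrC.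
Qed.

Lemma C_eq_small (x y : C) : (forall e : R, 0 < e -> `|x - y| <= e%:C) -> x = y.
Proof.
move=> xy; apply/eqP; rewrite -subr_eq0 -normr_le0 -[`|_|]Re_norm.
rewrite -(rmorph0 (@real_complex R)) lecR; apply/ler_addgt0Pr => e e0.
by rewrite add0r Re_norm_le xy.
Qed.

(** Boundedness is the point, and it comes from the independence of the [Q j] through
    [coord_bound]. *)
Lemma gcoord_Hinf (hilbertK : hilbert K) (Qi : lin_indep Q) j :
  gcoord Q j \in Hinf Q.
Proof.
have [dot dotE] := hilbertK.
have [c [c0 cb]] := coord_bound dotE Qi.
apply/in_Hinf; split; first by split=> [n m X Y W|n S X Y Su]; apply.
apply: (@gnorm_bounded _ _ _ _ _ _ (c * 1)); apply/gnorm_leP => n X.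
apply: cb => //; have /ncballP[_ [r [_ r1 Xr]]] := ptP X.
by apply: ncop_le_trans Xr; exact: ltW.
Qed.

Lemma gcoord_ballA (hilbertK : hilbert K) (Qi : lin_indep Q) j :
  gcoord Q j \in ballA Q.
Proof.
apply/in_ballA; split; first exact: gcoord_Hinf.
move=> e e0; exists [:: (1, [:: j])].
have -> : ncpoly_map [:: (1, [:: j])] = gcoord Q j.
  by rewrite /ncpoly_map !big_seq1 scale1r.
rewrite subrr; apply/gnorm_leP => n X; apply/mxnorm_leP; split; first exact: ltW.
move=> v; rewrite (_ : mxapp _ v = fun=> 0) ?l2norm0 ?mulr_ge0 ?l2norm_ge0 ?ltW//.
by apply/funext => i; rewrite /mxapp big1// => k _; rewrite mxE mul0r.
Qed.

End BallTopology.

(** * The ball algebra *)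

Section BallA.
Context {R : realType} {H K : completeNormedModType R[i]} {d : nat}.
Context {Q : 'I_d -> {linear H -> K}}.
Local Notation C := R[i].
Variable Z : 'I_d -> fun_alg (ballA Q).
Hypothesis ZE : forall j, val (Z j) = gcoord Q j.

(** A single [p] serves all levels and all representations; this uniformity gives continuity of the
    inverse of the evaluation map. *)
Lemma ballA_approx (g : fun_alg (ballA Q)) (e : R) : 0 < e ->
  exists p, forall n Phi, repcc (ballA Q) n Phi -> forall a b,
    `|Phi g a b - polyeval p (evalat Z n Phi) a b| <= e%:C.
Proof.
move=> e0; have /in_ballA[_ /(_ e e0)[p gp]] := valP g.
by exists p => n Phi PhiA a b; exact: repcc_approx.
Qed.

Lemma ballA_repcc_inj n (Phi Psi : {ptws fun_alg (ballA Q) -> 'M[C]_n}) :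
  repcc (ballA Q) n Phi -> repcc (ballA Q) n Psi ->
  evalat Z n Phi = evalat Z n Psi -> Phi = Psi.
Proof.
move=> PhiA PsiA PhiPsi; apply/funext => g; apply/matrixP => a b.
apply: C_eq_small => e e0.
have [|p gp] := @ballA_approx g (e / 2); first by rewrite divr_gt0.
have := gp n Phi PhiA a b; have := gp n Psi PsiA a b; rewrite PhiPsi.
set c := polyeval _ _ _ _ => Psic Phic.
have -> : Phi g a b - Psi g a b = (Phi g a b - c) - (Psi g a b - c) by ring.
rewrite (splitr e) rmorphD; apply: le_trans (ler_normB _ _) _; exact: lerD.
Qed.

Lemma ballA_homeo n : (0 < n)%N ->
  (forall Phi, repcc (ballA Q) n Phi -> cncball Q n (evalat Z n Phi)) ->
  homeo_on (repcc (ballA Q) n) (cncball Q n) (evalat Z n).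
Proof.
move=> n0 ZB; split; first exact/continuous_subspaceT/evalat_continuous.
have AH (f : gmap Q) : f \in ballA Q -> f \in Hinf Q by move=> /in_ballA[].
(* The inverse picks a representation over each point of the closed ball; the zero map is a filler
   elsewhere. *)
have /choice[G GP] (X : mxtuple R d n) : exists Phi,
    cncball Q n X -> repcc (ballA Q) n Phi /\ evalat Z n Phi = X.
  have [XB|XB] := pselect (cncball Q n X); last by exists (fun=> 0).
  by have [Phi ? ?] := repcc_exists ZE AH XB; exists Phi.
exists G; split=> [|//|X /GP[]//|Phi PhiA|X /GP[]//]; last first.
  have [GA GZ] := GP _ (ZB _ PhiA); exact: ballA_repcc_inj.
apply/subspace_continuousP => X XB.
have FF : Filter (within (cncball Q n) (nbhs X)) := within_filter _ (nbhs_filter X).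
apply: cvg_ptws => g; apply: cvg_mx => a b.
apply: cvg_uniform_approx => e e0; have [p gp] := ballA_approx g e0.
exists (fun Y => polyeval p Y a b), (polyeval p X a b); split.
- apply: cvg_within_filter; exact: polyeval_continuous.
- by have [GA {2}<-] := GP X XB; exact: gp.
- apply: filterS (withinT _ (nbhs_filter X)) => Y YB.
  by have [GA {2}<-] := GP Y YB; exact: gp.
Qed.

End BallA.

(** * Bounded nc functions and bounded-pointwise continuity *)

Section BallHinf.
Context {R : realType} {H K : completeNormedModType R[i]} {d : nat}.
Context {Q : 'I_d -> {linear H -> K}}.
Local Notation C := R[i].
Hypothesis Q_cont : forall j, continuous (Q j).
Variable Z : 'I_d -> fun_alg (Hinf Q).
Hypothesis ZE : forall j, val (Z j) = gcoord Q j.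

Lemma Hinf_bounded (f : fun_alg (Hinf Q)) : exists M : R,
  [/\ nc_function (val f), 0 <= M & (gnorm (val f) <= M%:E)%E].
Proof.
have [M M0 fM] := fun_alg_bounded (fun f (h : f \in Hinf Q) => h) f.
by exists M; split=> //; have /in_Hinf[] := valP f.
Qed.

Definition evalrep n (X : mxtuple R d n) (XB : ncball Q n X) :
    {ptws fun_alg (Hinf Q) -> 'M[C]_n} := fun f => val f n (pt XB).

Lemma evalrep_repcc n (X : mxtuple R d n) (XB : ncball Q n X) :
  repcc (Hinf Q) n (evalrep XB).
Proof.
split; first by move=> a u v; rewrite /evalrep linearP.
  by split=> // u v; rewrite /evalrep rmorphM.
by move=> k F; apply: ereal_sup_ubound; exists n, (pt XB).
Qed.

Lemma evalrepZ n (X : mxtuple R d n) (XB : ncball Q n X) :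
  evalat Z n (evalrep XB) = X.
Proof. by apply/funext => j; rewrite /evalat /evalrep ZE. Qed.

Lemma evalrep_bp_continuous n (X : mxtuple R d n) (XB : ncball Q n X) :
  continuous (evalrep XB : bpHinf Q -> 'M[C]_n).
Proof. by apply/bp_continuousP => F f FF _ Ff; exact: Ff. Qed.

(** On polynomials [Phi] is evaluation at Phi(Z). The Fejer polynomials of [f] are bounded by [M]
    and converge to [f] pointwise, so continuity extends the identity to [f]. *)
Lemma bp_continuous_repE n (Phi : {ptws fun_alg (Hinf Q) -> 'M[C]_n})
    (XB : ncball Q n (evalat Z n Phi)) :
  repcc (Hinf Q) n Phi -> continuous (Phi : bpHinf Q -> 'M[C]_n) ->
  Phi = evalrep XB.
Proof.
move=> PhiA Phic; apply/funext => f.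
have [M [fnc M0 fM]] := Hinf_bounded f.
have /choice[p pP] m := nc_fejer Q_cont m fnc M0 fM.
pose P m : bpHinf Q := polyalg Z (p m).
have PE m n' (Y : ncball Q n') : val (P m) n' Y = polyeval (p m) (val Y).
  by rewrite (val_polyalg ZE) ncpoly_mapE.
have Pf n' (Y : ncball Q n') a b : val (P m) n' Y a b @[m --> \oo] --> val f n' Y a b.
  apply/cvgCP => e e0; have /ncballP[_ [r [r0 r1 Yr]]] := ptP Y.
  have := fejer_near M r1 e0; apply: filterS => m me.
  have [_ /(_ n' Y r r0 r1 Yr)] := pP m.
  rewrite -PE => fP; have := mxnorm_entry a b fP; rewrite 2!mxE => /le_trans; apply.
  by rewrite lecR.
have Pb : bounded_net (P @ \oo).
  exists M; exists 0%N => // m _ /=; rewrite (val_polyalg ZE).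
  by have [] := pP m.
have Pp : pointwise_cvg (P @ \oo) f.
  by move=> n' Y; apply: cvg_mx => a b; exact: Pf.
have /bp_continuousP/(_ _ f _ Pb Pp) PhiP := Phic.
apply/matrixP => a b.
have h1 : Phi (P m) a b @[m --> \oo] --> Phi f a b.
  have := cvg_comp _ _ PhiP (@coord_continuous _ _ _ a b (Phi f)).
  exact.
apply: (@cvg_unique C (@norm_hausdorff C C) _ _ _ _ h1).
rewrite (_ : (fun m => _) = fun m => val (P m) n (pt XB) a b); first exact: Pf.
by apply/funext => m; rewrite PE -(repcc_polyalg Z (p m) PhiA).
Qed.

Lemma Hinf_homeo n : (0 < n)%N ->
  homeo_on
    [set Phi | repcc (Hinf Q) n Phi /\ ncball Q n (evalat Z n Phi) /\
               continuous (Phi : bpHinf Q -> 'M[R[i]]_n)]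
    (ncball Q n) (evalat Z n).
Proof.
move=> n0; split; first exact/continuous_subspaceT/evalat_continuous.
pose G X : {ptws fun_alg (Hinf Q) -> 'M[C]_n} :=
  if pselect (ncball Q n X) is left XB then evalrep XB else fun=> 0.
have GE X (XB : ncball Q n X) : G X = evalrep XB.
  rewrite /G; case: pselect => // XB'; congr evalrep; exact: Prop_irrelevance.
exists G; split=> [|Phi [_ []]//|X XB|Phi [PhiA [XB Phic]]|X XB]; last first.
- by rewrite (GE _ XB) evalrepZ.
- by rewrite (GE _ XB) -bp_continuous_repE.
- rewrite /= (GE _ XB) evalrepZ; split; first exact: evalrep_repcc.
  by split=> //; exact: evalrep_bp_continuous.
apply/subspace_continuousP => X XB.
have FF : Filter (within (ncball Q n) (nbhs X)) := within_filter _ (nbhs_filter X).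
apply: cvg_ptws => f; apply: cvg_mx => a b.
have [M [fnc M0 fM]] := Hinf_bounded f.
have /ncballP[_ [r0 [r00 r01 Xr0]]] := XB.
(* A radius strictly between that of [X] and 1: points near [X] have radius at most [r], where the
   Fejer error is uniform. *)
pose r := (r0 + 1) / 2.
have r0r : r0 < r by rewrite midf_lt.
have r1 : r < 1 by rewrite midf_lt.
have r0' : 0 <= r by exact: le_trans r00 (ltW r0r).
apply: cvg_uniform_approx => e e0.
have [m me] := filter_ex (fejer_near M r1 e0).
have [p [_ pP]] := nc_fejer Q_cont m fnc M0 fM.
have Gp Y : ncball Q n Y -> ncop_le Q Y r -> `|G Y f a b - polyeval p Y a b| <= e%:C.
  move=> YB Yr; rewrite (GE _ YB); have := mxnorm_entry a b (pP n (pt YB) r r0' r1 Yr).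
  by rewrite 2!mxE => /le_trans; apply; rewrite lecR.
exists (fun Y => polyeval p Y a b), (polyeval p X a b); split.
- apply: cvg_within_filter; exact: polyeval_continuous.
- by apply: Gp => //; apply: ncop_le_trans Xr0; exact: ltW.
- have Xr : within (ncball Q n) (nbhs X) [set Y | ncop_le Q Y r].
    by apply: filterS (ncop_le_near Q_cont r0r Xr0) => Y Yr _.
  by apply: filterS2 (withinT _ (nbhs_filter X)) Xr => Y; exact: Gp.
Qed.

End BallHinf.

Theorem proposition5p1 (R : realType) (H K : completeNormedModType R[i])
    (hilbertH : hilbert H) (hilbertK : hilbert K) (d : nat)
    (Q : 'I_d -> {linear H -> K}) (Q_cont : forall j, continuous (Q j))
    (Q_indep : lin_indep Q) :
  (exists Z : 'I_d -> fun_alg (ballA Q),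
    (forall j, val (Z j) = gcoord Q j) /\
    forall n : nat, (0 < n)%N ->
      {within repcc (ballA Q) n, continuous (evalat Z n)} /\
      evalat Z n @` repcc (ballA Q) n = cncball Q n /\
      homeo_on (repcc (ballA Q) n) (cncball Q n) (evalat Z n)) /\
  (exists Z : 'I_d -> fun_alg (Hinf Q),
    (forall j, val (Z j) = gcoord Q j) /\
    forall n : nat, (0 < n)%N ->
      {within repcc (Hinf Q) n, continuous (evalat Z n)} /\
      evalat Z n @` repcc (Hinf Q) n = cncball Q n /\
      homeo_on
        [set Phi | repcc (Hinf Q) n Phi /\ ncball Q n (evalat Z n Phi) /\
                   continuous (Phi : bpHinf Q -> 'M[R[i]]_n)]
        (ncball Q n) (evalat Z n)).
Proof.
have [dotH dotHE] := hilbertH; have [dotK dotKE] := hilbertK.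
have ballH (f : gmap Q) : f \in ballA Q -> f \in Hinf Q by case/in_ballA.
split.
- pose Z j : fun_alg (ballA Q) := Sub (gcoord Q j) (gcoord_ballA hilbertK Q_indep j).
  have ZE j : val (Z j) = gcoord Q j by exact: SubK.
  have ZB n (Phi : {ptws fun_alg (ballA Q) -> 'M[R[i]]_n}) : (0 < n)%N ->
      repcc (ballA Q) n Phi -> cncball Q n (evalat Z n Phi).
    exact: (repcc_cncball dotHE dotKE ZE).
  exists Z; split=> // n n0; split; last split.
  + exact/continuous_subspaceT/evalat_continuous.
  + apply/seteqP; split=> [_ [Phi PhiA <-]|X XB]; first exact: ZB.
    by have [Phi ? ?] := repcc_exists ZE ballH XB; exists Phi.
  + by apply: ballA_homeo => // Phi; exact: ZB.
- pose Z j : fun_alg (Hinf Q) := Sub (gcoord Q j) (gcoord_Hinf hilbertK Q_indep j).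
  have ZE j : val (Z j) = gcoord Q j by exact: SubK.
  exists Z; split=> // n n0; split; last split.
  + exact/continuous_subspaceT/evalat_continuous.
  (* Evaluations reach only the open ball; boundary points need the ultrafilter limits of
     [repcc_exists]. *)
  + apply/seteqP; split=> [_ [Phi PhiA <-]|X XB].
      exact: (repcc_cncball dotHE dotKE ZE).
    by have [Phi ? ?] := repcc_exists ZE (fun f fH => fH) XB; exists Phi.
  + exact: Hinf_homeo.
Qed.
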